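(* For integers $d\ge 1$ and $g\ge 3$, let $\rho(d,g)$ be the supremum of $|V(G)|/\alpha(G)$ over all finite graphs $G$ with maximum degree at most $d$ and girth at least $g$ (equivalently, the supremum of the Hall ratios of such graphs). Then the following upper bounds hold: for $d=3$: $\rho(3,6)\le \frac{30}{11}$, $\rho(3,7)\le\frac{30}{11}$, $\rho(3,8)\le \frac{5849}{2228}$, $\rho(3,9)\le\frac{125}{48}$, $\rho(3,10)\le \frac{2098873192}{820777797}$, $\rho(3,11)\le\frac{14147193}{5571665}$, $\rho(3,12)\le \frac{29727802051155412}{11841961450578397}$; for $d=4$: $\rho(4,6)\le\frac{41}{13}$, $\rho(4,7)\le\frac{41}{13}$, $\rho(4,8)\le\frac{7083927}{2331392}$, $\rho(4,9)\le \frac{127937}{42400}$, $\rho(4,10)\le 3$; for $d=5$: $\rho(5,6)\le\frac{69}{19}$, $\rho(5,7)\le \frac{18}{5}$, $\rho(5,8)\le\frac{7}{2}$.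
   Context: $\alpha(G)$ denotes the independence number of $G$. The Hall ratio of $G$ is $\max\{|V(H)|/\alpha(H) : H\subseteq G\}$. The girth of a graph is the length of a shortest cycle ($+\infty$ for forests). *)

(* Defs.v *)
From mathcomp Require Import all_boot.
From Stdlib Require Import Reals.
From Coquelicot Require Import Coquelicot.

Set Implicit Arguments.
Unset Strict Implicit.
Unset Printing Implicit Defensive.

Local Open Scope nat_scope.

Record sgraph := SGraph {
  vertex :> finType;
  edge : rel vertex;
  edge_sym : symmetric edge;
  edge_irrefl : irreflexive edge }.

Definition degree (G : sgraph) (x : G) : nat := #|[set y | edge x y]|.

Definition max_degree (G : sgraph) : nat := \max_(x : G) degree x.

Definition independent (G : sgraph) (A : {set G}) : bool :=
  [forall x in A, forall y in A, ~~ edge x y].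

Definition alpha (G : sgraph) : nat :=
  \max_(A : {set G} | independent A) #|A|.

(* A cycle is given by the sequence of its distinct vertices; without the
   size condition, a vertex and an edge would count as cycles. *)
Definition is_cycle (G : sgraph) (c : seq G) : Prop :=
  3 <= size c /\ ucycle (@edge G) c.

(* The greatest lower bound of the empty set is [p_infty]. *)
Definition girth (G : sgraph) : Rbar :=
  Glb_Rbar (fun l : R => exists2 c : seq G, is_cycle c & l = INR (size c)).

(* The subgraph of [G] with vertex set [S] whose edges are the edges xy of
   [G] with x, y in [S] and {x, y} in [F].  Every subgraph of [G] is of this
   form, [F] being its edge set, and no condition on [F] is needed. *)
Definition sub_edge (G : sgraph) (S : {set G}) (F : {set {set G}}) :
    rel {x : G | x \in S} :=
  [rel u v | edge (val u) (val v) && ([set val u; val v] \in F)].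

Lemma sub_edge_sym (G : sgraph) (S : {set G}) (F : {set {set G}}) :
  symmetric (@sub_edge G S F).
Proof. by move=> u v; rewrite /sub_edge /= edge_sym setUC. Qed.

Lemma sub_edge_irrefl (G : sgraph) (S : {set G}) (F : {set {set G}}) :
  irreflexive (@sub_edge G S F).
Proof. by move=> u; rewrite /sub_edge /= edge_irrefl. Qed.

Definition subgraph (G : sgraph) (S : {set G}) (F : {set {set G}}) : sgraph :=
  SGraph (@sub_edge_sym G S F) (@sub_edge_irrefl G S F).

Definition indep_ratio (G : sgraph) : R := (INR #|G| / INR (alpha G))%R.

(* The ratios are nonnegative, so the unit [0] of the iterated [Rmax] does
   not affect the maximum. *)
Definition hall_ratio (G : sgraph) : R :=
  \big[Rmax/0%R]_(S : {set G} | S != set0)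
    \big[Rmax/0%R]_(F : {set {set G}}) indep_ratio (subgraph S F).

Definition in_class (d g : nat) (G : sgraph) : Prop :=
  0 < #|G| /\ max_degree G <= d /\ Rbar_le (INR g) (girth G).

Definition rho (d g : nat) : Rbar :=
  Lub_Rbar (fun r : R => exists2 G : sgraph, in_class d g G & r = indep_ratio G).

Definition rho_hall (d g : nat) : Rbar :=
  Lub_Rbar (fun r : R => exists2 G : sgraph, in_class d g G & r = hall_ratio G).

(* Main.v *)
(** Let [I] be a uniformly random maximum independent set of a [d]-regular
    graph of large girth, and let [B] be the ball of radius [r] around a vertex
    (or around an edge), which induces a tree.  Given [J := I \ B], the set
    [I :&: B] is a uniformly random maximum independent set of the forest
    induced by the vertices of [B] without neighbour in [J]; only vertices of
    the last layer of [B] can be missing from that forest.  Suppose that giving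
    weight [a_i] to the vertices at distance [i] from the root makes the
    expected weight of such a random set at least [D], for each of the possible
    forests.  Summing over all roots, each vertex of [I] is counted with the
    same total weight [C], so that [D |V| <= C alpha].  The weights are optimal
    solutions of the linear programs given by the forests.  The possible
    forests are enumerated branch by branch, keeping for each branch only the
    numbers and the total weights of its maximum independent sets, and
    discarding the branches dominated by another one.

    For girth 6 (and for [d = 5]), radius 2 suffices once the weight of a vertex
    of [I] also depends on whether it has a private neighbour, that is, a
    neighbour whose only neighbour in [I] it is.

    Graphs that are not regular are reduced to regular ones: copies of the
    graph indexed by a finite group generated by involutions without short
    relations are joined by the edges of the Cayley graph. *)

Require Import Defs.
From mathcomp Require Import all_boot fingroup perm.
From Stdlib Require Import Reals Lra.
From Coquelicot Require Import Coquelicot.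
From Stdlib Require Import ZArith NArith.
From mathcomp Require Import ssrZ zify.

Set Implicit Arguments.
Unset Strict Implicit.
Unset Printing Implicit Defensive.

Local Open Scope nat_scope.

(** * Maximum independent sets *)

Section MaximumIndependentSets.

Variable G : sgraph.
Implicit Types (S A B K : {set G}) (c x y : G).

Definition indep_in S K := (K \subset S) && independent K.

Definition mis S := \max_(K : {set G} | indep_in S K) #|K|.

Definition MI S := [set K : {set G} | indep_in S K && (#|K| == mis S)].

Lemma independentP K :
  reflect {in K &, forall x y, ~~ edge x y} (independent K).
Proof.
apply: (iffP forall_inP) => [H x y Kx Ky | H x Kx]; first exact: (forall_inP (H x Kx)).
by apply/forall_inP => y; apply: H.
Qed.

Lemma independentS K K' : K' \subset K -> independent K -> independent K'.
Proof.
move=> /subsetP sK /independentP iK; apply/independentP => x y /sK Kx /sK Ky.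
exact: iK.
Qed.

Lemma leq_mis S K : K \subset S -> independent K -> #|K| <= mis S.
Proof. by move=> sK iK; apply: (@leq_bigmax_cond _ _ (fun K => #|K|)); rewrite /indep_in sK. Qed.

Lemma MIP S K :
  reflect [/\ K \subset S, independent K & #|K| = mis S] (K \in MI S).
Proof.
rewrite inE; apply: (iffP andP) => [[/andP[? ?] /eqP ?] | [? ? ?]] //.
by split; [apply/andP | apply/eqP].
Qed.

Lemma ex_MI S : exists K, K \in MI S.
Proof.
have P0 : indep_in S set0.
  by rewrite /indep_in sub0set; apply/independentP => x y; rewrite inE.
have [|K PK eK] := @eq_bigmax_cond _ (indep_in S) (fun K => #|K|).
  by apply/card_gt0P; exists set0.
by exists K; rewrite inE [mis S]eK eqxx andbT.
Qed.

Lemma misS S S' : S \subset S' -> mis S <= mis S'.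
Proof.
by move=> sS; have [K /MIP[sK iK <-]] := ex_MI S; apply: leq_mis => //; apply: subset_trans sS.
Qed.

Lemma mis_alpha : mis setT = alpha G.
Proof. by apply: eq_bigl => K; rewrite /indep_in subsetT. Qed.

Definition separated A B := {in A & B, forall x y, (x != y) && ~~ edge x y}.

Lemma independentU A B K1 K2 : separated A B -> K1 \subset A -> K2 \subset B ->
  independent (K1 :|: K2) = independent K1 && independent K2.
Proof.
move=> sAB /subsetP s1 /subsetP s2; apply/idP/andP => [iK | [/independentP i1 /independentP i2]].
  by split; apply: independentS iK; rewrite (subsetUl, subsetUr).
apply/independentP => x y /setUP[Kx|Kx] /setUP[Ky|Ky]; first exact: i1.
- by have /andP[] := sAB _ _ (s1 _ Kx) (s2 _ Ky).
- by rewrite edge_sym; have /andP[] := sAB _ _ (s1 _ Ky) (s2 _ Kx).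
exact: i2.
Qed.

Lemma separated_disjoint A B : separated A B -> [disjoint A & B].
Proof.
move=> sAB; rewrite -setI_eq0; apply/eqP/setP => x; rewrite !inE.
by apply/andP => -[Ax Bx]; have := sAB _ _ Ax Bx; rewrite eqxx.
Qed.

Lemma card_separatedU A B K1 K2 : separated A B -> K1 \subset A -> K2 \subset B ->
  #|K1 :|: K2| = #|K1| + #|K2|.
Proof.
move=> /separated_disjoint dAB s1 s2; rewrite cardsU.
have -> : K1 :&: K2 = set0; last by rewrite cards0 subn0.
apply/eqP; rewrite -subset0 -(eqP (_ : A :&: B == set0)) ?setISS //.
by rewrite setI_eq0.
Qed.

Lemma misU A B : separated A B -> mis (A :|: B) = mis A + mis B.
Proof.
move=> sAB; apply/eqP; rewrite eqn_leq; apply/andP; split.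
  have [K /MIP[sK iK <-]] := ex_MI (A :|: B).
  have -> : K = (K :&: A) :|: (K :&: B) by rewrite -setIUr; apply/esym/setIidPl.
  rewrite (card_separatedU sAB) ?subsetIr // leq_add //; apply: leq_mis; rewrite ?subsetIr //;
    by apply: independentS iK; rewrite subsetIl.
have [K1 /MIP[s1 i1 <-]] := ex_MI A; have [K2 /MIP[s2 i2 <-]] := ex_MI B.
rewrite -(card_separatedU sAB) //; apply: leq_mis; first exact: setUSS.
by rewrite (independentU sAB) // i1.
Qed.

(** Both parts of a maximum independent set of a disjoint union are maximum, so
    [K -> (K :&: A, K :&: B)] is a bijection. The arbitrary [F] serves for the number of sets as
    well as for their weight. *)
Lemma sum_MI_U (F : {set G} -> nat) A B : separated A B ->
  \sum_(K in MI (A :|: B)) F K =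
  \sum_(K1 in MI A) \sum_(K2 in MI B) F (K1 :|: K2).
Proof.
move=> sAB; rewrite pair_big /=.
rewrite (reindex_onto (fun p : {set G} * {set G} => p.1 :|: p.2)
                      (fun K => (K :&: A, K :&: B))) /=; last first.
  by move=> K /MIP[/setIidPl + _ _]; rewrite setIUr.
have dAB : A :&: B = set0 by apply/eqP; rewrite setI_eq0; apply: separated_disjoint.
apply: eq_bigl => -[K1 K2] /=.
have [s1|n1] := boolP (K1 \subset A); last first.
  have /negPf -> : K1 \notin MI A by apply/MIP => -[]; rewrite (negPf n1).
  by rewrite andbC; apply: contraNF n1 => /andP[/eqP[<- _] _]; rewrite subsetIr.
have [s2|n2] := boolP (K2 \subset B); last first.
  have /negPf -> : K2 \notin MI B by apply/MIP => -[]; rewrite (negPf n2).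
  by rewrite andbF andbC; apply: contraNF n2 => /andP[/eqP[_ <-] _]; rewrite subsetIr.
have e1 : (K1 :|: K2) :&: A = K1.
  rewrite setIUl (setIidPl s1) (_ : K2 :&: A = set0) ?setU0 //.
  by apply/eqP; rewrite -subset0 -dAB setIC setIS.
have e2 : (K1 :|: K2) :&: B = K2.
  rewrite setIUl (setIidPl s2) (_ : K1 :&: B = set0) ?set0U //.
  by apply/eqP; rewrite -subset0 -dAB setSI.
rewrite e1 e2 eqxx andbT.
rewrite !inE /indep_in s1 s2 setUSS //= (independentU sAB) // (card_separatedU sAB) // misU //.
case i1: (independent K1) => //=; case i2: (independent K2) => /=; last by rewrite andbF.
have := leq_mis s1 i1; have := leq_mis s2 i2; lia.
Qed.

Definition delN S c := [set x in S | ~~ edge c x].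

Lemma independentU1 c K : c \notin K ->
  independent (c |: K) = independent K && [forall x in K, ~~ edge c x].
Proof.
move=> ncK; apply/independentP/andP => [iK | [/independentP iK /forall_inP cK] x y].
  split; first by apply/independentP => x y Kx Ky; apply: iK; rewrite !inE ?Kx ?Ky orbT.
  by apply/forall_inP => x Kx; apply: iK; rewrite !inE ?eqxx ?Kx ?orbT.
rewrite !inE => /orP[/eqP->|Kx] /orP[/eqP->|Ky]; rewrite ?edge_irrefl //; first exact: cK.
- by rewrite edge_sym; apply: cK.
- exact: iK.
Qed.

Lemma indep_in_U1 c S K : c \notin K -> c \notin S ->
  indep_in (c |: S) (c |: K) = indep_in (delN S c) K.
Proof.
move=> ncK ncS; rewrite /indep_in independentU1 // andbCA andbA [RHS]andbC -andbA; congr (_ && _).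
apply/andP/subsetP => [[/subsetP sK /forall_inP cK] x Kx | sK].
  have := sK x; rewrite !inE Kx orbT => /(_ isT); rewrite cK // andbT.
  by case: eqP => // ex; move: Kx; rewrite ex (negPf ncK).
split; last by apply/forall_inP => x /sK; rewrite inE => /andP[].
by apply/setUS/subsetP => x /sK; rewrite inE => /andP[].
Qed.

Lemma indep_in_notin c S K : c \notin K -> indep_in (c |: S) K = indep_in S K.
Proof.
move=> ncK; rewrite /indep_in; congr (_ && _); apply/subsetP/subsetP => sK x Kx.
  have := sK x Kx; rewrite !inE; case: eqP => // ex; move: Kx; by rewrite ex (negPf ncK).
by rewrite inE sK ?orbT.
Qed.

Lemma misU1 c S : c \notin S -> mis (c |: S) = maxn (mis S) (mis (delN S c)).+1.
Proof.
move=> ncS; have nK K S' : S' \subset S -> indep_in S' K -> c \notin K.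
  by move=> sS /andP[sK _]; apply: contra ncS; apply/subsetP/(subset_trans sK).
have sD : delN S c \subset S by apply/subsetP => x; rewrite inE => /andP[].
apply/eqP; rewrite eqn_leq geq_max misS ?subsetUr //=; apply/andP; split; last first.
  have [K] := ex_MI (delN S c); rewrite inE => /andP[iK /eqP <-].
  have ncK := nK _ _ sD iK; move: iK; rewrite -indep_in_U1 // => /andP[sK iK].
  by have := leq_mis sK iK; rewrite cardsU1 ncK.
have [K /MIP[sK iK <-]] := ex_MI (c |: S); rewrite leq_max.
have [cK|ncK] := boolP (c \in K).
  have nc' : c \notin K :\ c by rewrite !inE eqxx.
  have : indep_in (delN S c) (K :\ c) by rewrite -indep_in_U1 // setD1K // /indep_in sK.
  case/andP => sK' iK'; apply/orP; right; rewrite (cardsD1 c) cK add1n ltnS.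
  exact: leq_mis.
have : indep_in S K by rewrite -(indep_in_notin S ncK) /indep_in sK.
by case/andP => sK' iK'; rewrite leq_mis.
Qed.

(** The sum splits into the sets that avoid [c] and those that contain it. Each boolean factor is 1
    exactly when that kind reaches the maximum size given by [misU1]; on a tie both do. *)
Lemma sum_MI_U1 (F : {set G} -> nat) c S : c \notin S ->
  \sum_(K in MI (c |: S)) F K =
    (mis (delN S c) < mis S) * (\sum_(K in MI S) F K) +
    (mis S <= (mis (delN S c)).+1) * (\sum_(K in MI (delN S c)) F (c |: K)).
Proof.
move=> ncS; have ncD : c \notin delN S c by rewrite inE (negPf ncS).
have nK K S' : c \notin S' -> indep_in S' K -> c \notin K.
  by move=> nc /andP[/subsetP sK _]; apply: contra nc; apply: sK.
rewrite (bigID (fun K : {set G} => c \notin K)) /=; congr (_ + _).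
  have inS K : c \notin K -> (K \in MI (c |: S)) = indep_in S K && (#|K| == mis (c |: S)).
    by move=> ncK; rewrite inE indep_in_notin.
  case: ltnP => [lt_DS|le_SD]; rewrite ?mul1n ?mul0n.
    apply: eq_bigl => K; have [ncK|cK] /= := boolP (c \notin K); last first.
      by rewrite andbF; apply/esym; apply: contraNF cK; rewrite inE => /andP[+ _]; apply: nK.
    by rewrite inS // andbT misU1 // (maxn_idPl lt_DS) inE.
  rewrite big1 // => K /andP[+ ncK]; rewrite inS // misU1 // => /andP[/andP[sK iK]].
  by move=> /eqP cK; have := leq_mis sK iK; rewrite cK; lia.
rewrite (reindex_onto (fun K => c |: K) (fun K => K :\ c)) /=; last first.
  by move=> K /andP[_ /negPn cK]; rewrite setD1K.
have eqP1 K : [&& (c |: K \in MI (c |: S)), ~~ (c \notin c |: K) & (c |: K) :\ c == K] =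
    [&& c \notin K, indep_in (delN S c) K & #|K|.+1 == mis (c |: S)].
  rewrite setU11 /=; have [cK|ncK] /= := boolP (c \in K).
    by apply/negbTE/negP => /andP[_ /eqP e]; move: cK; rewrite -e !inE eqxx.
  rewrite setU1K // eqxx andbT inE indep_in_U1 // cardsU1 ncK add1n.
  by [].
case: leqP => [le_SD|lt_DS]; rewrite ?mul1n ?mul0n.
  apply: eq_bigl => K; rewrite -andbA eqP1 misU1 // (maxn_idPr le_SD) eqSS inE.
  apply/andP/idP => [[] //|iK]; split=> //.
  by case/andP: iK => /(nK _ _ ncD).
rewrite big1 // => K; rewrite -andbA eqP1 misU1 // => /and3P[_ /andP[sK iK]].
by rewrite (maxn_idPl (ltnW lt_DS)) => /eqP cK; have := leq_mis sK iK; lia.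
Qed.

End MaximumIndependentSets.

(** * Counting maximum independent sets of rooted forests *)

(* A pair [(n, w)] stands for [n + w e] with [e ^ 2 = 0]: [n] sets of total weight
   [w].  Disjoint unions of forests multiply these numbers. *)
Definition dual := (Z * Z)%type.

Definition dadd (x y : dual) : dual := (x.1 + y.1, x.2 + y.2)%Z.

Definition dmul (x y : dual) : dual := (x.1 * y.1, x.1 * y.2 + x.2 * y.1)%Z.

Definition dlift (a : Z) (x : dual) : dual := (x.1, x.2 + a * x.1)%Z.

(* [(k, o, m)] describes a branch [S] with top [c]: [m] counts the maximum
   independent sets of [S], [o] those of [S] without [c], and [k] is the
   difference of their sizes.  A list of branches is described likewise by the
   sums of the [k]s and the products of the [o]s and of the [m]s. *)
Definition state := (nat * dual * dual)%type.

Definition unit_state : state := (0, (1, 0)%Z, (1, 0)%Z).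

Definition smerge (s t : state) : state :=
  let: (k, o, m) := s in let: (k', o', m') := t in (k + k', dmul o o', dmul m m').

(* The branch obtained by hanging branches under a new top of weight [a]: using
   the top costs [k] vertices in them and gains one. *)
Definition vtx (a : Z) (s : state) : state :=
  let: (k, o, m) := s in
  match k with
  | 0 => (1, m, dlift a o)
  | 1 => (0, m, dadd (dlift a o) m)
  | _ => (0, m, m)
  end.

Definition smergel (l : seq state) := foldr smerge unit_state l.

Section GraphStates.

Variables (G : sgraph) (w : G -> nat).
Implicit Types (S A B K : {set G}) (c x y : G) (cs : seq G).

Definition opt S : dual :=
  (Z.of_nat #|MI S|, Z.of_nat (\sum_(K in MI S) \sum_(x in K) w x)).

Definition st S c : state := (mis S - mis (S :\ c), opt (S :\ c), opt S).

Lemma card_sum_MI S : #|MI S| = \sum_(K in MI S) 1.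
Proof. by rewrite sum1_card. Qed.

Lemma opt_U A B : separated A B -> opt (A :|: B) = dmul (opt A) (opt B).
Proof.
move=> sAB; have dAB := separated_disjoint sAB.
rewrite /opt /dmul /= !card_sum_MI !sum_MI_U //; congr pair.
  rewrite -Nat2Z.inj_mul; congr Z.of_nat.
  by under eq_bigr => K _ do rewrite sum1_card; rewrite sum_nat_const !sum1_card.
rewrite -!Nat2Z.inj_mul -Nat2Z.inj_add; congr Z.of_nat; rewrite !sum1_card.
transitivity (\sum_(K1 in MI A) \sum_(K2 in MI B)
    (\sum_(x in K1) w x + \sum_(x in K2) w x)).
  apply: eq_bigr => K1 /MIP[s1 _ _]; apply: eq_bigr => K2 /MIP[s2 _ _].
  rewrite (eq_bigl [predU K1 & K2]); last by move=> x; rewrite !inE.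
  by rewrite bigU //; apply: disjointW s1 s2 dAB.
under eq_bigr => K1 _ do rewrite big_split /= sum_nat_const.
rewrite big_split /= sum_nat_const -big_distrr /=; lia.
Qed.

Lemma opt_U1 c S : c \notin S ->
  opt (c |: S) =
    if mis S <= mis (delN S c) then dlift (Z.of_nat (w c)) (opt (delN S c))
    else if mis S == (mis (delN S c)).+1
         then dadd (dlift (Z.of_nat (w c)) (opt (delN S c))) (opt S)
         else opt S.
Proof.
move=> ncS; rewrite {1}/opt !card_sum_MI !sum_MI_U1 //.
have -> : \sum_(K in MI (delN S c)) \sum_(x in c |: K) w x =
    \sum_(K in MI (delN S c)) \sum_(x in K) w x + w c * #|MI (delN S c)|.
  under eq_bigr => K KD.
    rewrite big_setU1 /=; last first.
      by have [/subsetP sK _ _] := MIP _ _ KD; apply/negP => /sK; rewrite inE (negPf ncS).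
    over.
  by rewrite big_split /= sum_nat_const addnC mulnC.
rewrite !sum1_card /opt /dlift /dadd /=.
case: (ltngtP (mis S) (mis (delN S c)).+1) => [|lt|eqS].
- rewrite ltnS => le; rewrite le /=; congr pair; lia.
- have -> : (mis S <= mis (delN S c)) = false by lia.
  rewrite /=.  congr pair; lia.
have -> : (mis S <= mis (delN S c)) = false by lia.
by rewrite /=; congr pair; lia.
Qed.

Lemma separated_bigcup A (S_ : G -> {set G}) cs :
  {in cs, forall x, separated A (S_ x)} -> separated A (\bigcup_(x <- cs) S_ x).
Proof.
elim: cs => [_|x cs IH sA]; first by rewrite big_nil => a b _; rewrite inE.
rewrite big_cons => a b Aa /setUP[]; first by apply: sA; rewrite ?mem_head.
by apply: IH => // y ys; apply: sA; rewrite inE ys orbT.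
Qed.

(** Separated branches contribute independently. [UD], the union without the tops, is what remains
    available once a common neighbour of the tops is taken. *)
Lemma smergel_st (S_ : G -> {set G}) cs :
  uniq cs -> {in cs &, forall x y, x != y -> separated (S_ x) (S_ y)} ->
  let US := \bigcup_(x <- cs) S_ x in
  let UD := \bigcup_(x <- cs) (S_ x :\ x) in
  mis UD <= mis US /\
  smergel [seq st (S_ x) x | x <- cs] = (mis US - mis UD, opt UD, opt US).
Proof.
elim: cs => [_ _|c cs IH /= /andP[ncs ucs] sS].
  rewrite !big_nil /= subnn /unit_state; split=> //.
  have eM : MI (set0 : {set G}) = [set set0].
    have sub0 K : K \in MI (set0 : {set G}) -> K = set0.
      by case/MIP; rewrite subset0 => /eqP.
    have [K0 K0M] := ex_MI (set0 : {set G}); have e0 := sub0 _ K0M.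
    apply/setP => K; rewrite in_set1; apply/idP/eqP => [/sub0 //|->].
    by rewrite -[X in X \in _]e0.
  by rewrite /opt eM cards1 big_set1 big_set0.
have [le_ IH2] := IH ucs (fun x y xs ys => sS x y (mem_behead (s := c :: cs) xs) (mem_behead (s := c :: cs) ys)).
rewrite !big_cons.
have sU : separated (S_ c) (\bigcup_(x <- cs) S_ x).
  apply: separated_bigcup => x xs; apply: sS; rewrite ?inE ?eqxx ?xs ?orbT //.
  by apply: contraNneq ncs => ->.
have sD : separated (S_ c :\ c) (\bigcup_(x <- cs) (S_ x :\ x)).
  apply: separated_bigcup => x xs a b /setD1P[_ Sa] /setD1P[_ Sb].
  apply: (sS c x) Sa Sb; rewrite ?inE ?eqxx ?xs ?orbT //.
  by apply: contraNneq ncs => ->.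
have leD : mis (S_ c :\ c) <= mis (S_ c) by apply: misS; rewrite subD1set.
rewrite !misU // !opt_U // IH2 /st /smerge; split; first by rewrite leq_add.
by congr (_, _, _); lia.
Qed.

(** The neighbours of [c] in the branches are exactly their tops, so taking [c] turns [US] into
    [UD]; the difference of their [mis] is the [k] on which [vtx] branches. *)
Lemma st_star (S_ : G -> {set G}) cs c :
  uniq cs -> {in cs &, forall x y, x != y -> separated (S_ x) (S_ y)} ->
  {in cs, forall x, {in S_ x, forall y, (y != c) && (edge c y == (y == x))}} ->
  st (c |: \bigcup_(x <- cs) S_ x) c =
  vtx (Z.of_nat (w c)) (smergel [seq st (S_ x) x | x <- cs]).
Proof.
move=> ucs sS adj; have [leU ->] := smergel_st ucs sS.
set US := \bigcup_(x <- cs) S_ x in leU *; set UD := \bigcup_(x <- cs) _ in leU *.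
have ncU : c \notin US.
  apply/negP; rewrite /US; elim: (cs) adj => [_|x l IH adj]; rewrite ?big_nil ?inE //.
  rewrite big_cons => /setUP[/adj|].
    by rewrite mem_head eqxx => /(_ isT).
  by apply: IH => y yl; apply: adj; rewrite inE yl orbT.
have dU : delN US c = UD.
  rewrite /US /UD; elim: (cs) adj => [_|x l IH adj]; first by apply/setP => y; rewrite !big_nil !inE.
  rewrite !big_cons -IH; last by move=> y yl; apply: adj; rewrite inE yl orbT.
  apply/setP => y; rewrite !inE andb_orl; congr (_ || _); rewrite andbC.
  have [Sy|] := boolP (y \in S_ x); rewrite ?andbF //.
  by have /andP[_ /eqP->] := adj _ (mem_head _ _) _ Sy.
rewrite /st setU1K // opt_U1 // misU1 // dU.
have [leM|ltM] := leqP (mis US) (mis UD).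
  have -> : mis US = mis UD by lia.
  by rewrite (maxn_idPr _) // subnn subSnn.
case: eqP => [->|neM]; first by rewrite maxnn subnn subSnn.
rewrite (maxn_idPl _) ?subnn //=; try lia.
by case E: (mis US - mis UD) => [|[|k]]; try lia.
Qed.

Lemma st_set0 c : st set0 c = unit_state.
Proof.
have [_] := @smergel_st (fun=> set0) [::] isT (fun x y xs => False_ind _ (notF xs)).
by rewrite !big_nil /st set0D subnn.
Qed.

End GraphStates.

(** * Finite tables of branches *)

Definition pos (s : state) : Prop := (0 < s.1.2.1 /\ 0 < s.2.1)%Z.

(* [cov s t]: up to a scaling that leaves all averages unchanged, [s] and [t] have
   the same counts, and the weights in [t] are at most those in [s]. *)
Definition cov (s t : state) : Prop :=
  [/\ s.1.1 = t.1.1, pos s, pos t &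
    exists p q : Z, [/\ (0 < p)%Z, (0 < q)%Z,
      (p * s.1.2.1 = q * t.1.2.1)%Z /\ (q * t.1.2.2 <= p * s.1.2.2)%Z &
      (p * s.2.1 = q * t.2.1)%Z /\ (q * t.2.2 <= p * s.2.2)%Z]].

Lemma cov_refl s : pos s -> cov s s.
Proof. by move=> ps; split=> //; exists 1%Z, 1%Z; split; lia. Qed.

Lemma cov_unit : cov unit_state unit_state.
Proof. by apply: cov_refl; split. Qed.

(** Scalings multiply. The weight of a product is a sum of weights times counts, and the counts are
    nonnegative after scaling, so the inequalities survive. *)
Lemma dmul_scale (p q p' q' : Z) (x y x' y' : dual) :
  (0 < p)%Z -> (0 < p')%Z -> (0 < x.1)%Z -> (0 < x'.1)%Z ->
  (p * x.1 = q * y.1)%Z /\ (q * y.2 <= p * x.2)%Z ->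
  (p' * x'.1 = q' * y'.1)%Z /\ (q' * y'.2 <= p' * x'.2)%Z ->
  (p * p' * (dmul x x').1 = q * q' * (dmul y y').1)%Z /\
  (q * q' * (dmul y y').2 <= p * p' * (dmul x x').2)%Z.
Proof.
case: x y x' y' => [n w] [m v] [n' w'] [m' v'] /= p0 p'0 n0 n'0 [e l] [e' l'].
have -> : (p * p' * (n * n') = (p * n) * (p' * n'))%Z by ring.
have -> : (p * p' * (n * w' + w * n') = (p * n) * (p' * w') + (p * w) * (p' * n'))%Z by ring.
rewrite e e'; split; first by ring.
have m1 : (0 <= q * m)%Z by rewrite -e; apply: Z.mul_nonneg_nonneg; lia.
have m2 : (0 <= q' * m')%Z by rewrite -e'; apply: Z.mul_nonneg_nonneg; lia.
have := Z.mul_le_mono_nonneg_l _ _ _ m1 l'.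
have := Z.mul_le_mono_nonneg_r _ _ _ m2 l.
lia.
Qed.

Lemma smergeE s t :
  smerge s t = (s.1.1 + t.1.1, dmul s.1.2 t.1.2, dmul s.2 t.2).
Proof. by case: s t => [[k o] m] [[k' o'] m']. Qed.

Lemma pos_smerge s t : pos s -> pos t -> pos (smerge s t).
Proof. by rewrite smergeE => -[? ?] [? ?]; split; apply: Z.mul_pos_pos. Qed.

Lemma cov_smerge s t s' t' : cov s t -> cov s' t' -> cov (smerge s s') (smerge t t').
Proof.
move=> [ek ps pt [p [q [p0 q0 eo em]]]] [ek' ps' pt' [p' [q' [p0' q0' eo' em']]]].
split; [by rewrite !smergeE /= ek ek' | exact: pos_smerge | exact: pos_smerge |].
case: ps ps' => so sm [so' sm'].
exists (p * p')%Z, (q * q')%Z; rewrite !smergeE; split; try exact: Z.mul_pos_pos.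
  exact: dmul_scale.
exact: dmul_scale.
Qed.

Lemma pos_vtx a s : pos s -> pos (vtx a s).
Proof.
by case: s => [[[|[|k]] [n w]] [n1 w1]]; rewrite /pos /=; lia.
Qed.

(** Each case of [vtx] is linear in [o] and [m]. The case [k = 1] adds them, which is why [cov] asks
    for one scaling [p], [q] common to both. *)
Lemma cov_vtx a s t : cov s t -> cov (vtx a s) (vtx a t).
Proof.
move=> [ek ps pt [p [q [p0 q0 eo em]]]]; have := pos_vtx a ps; have := pos_vtx a pt.
case: s t ek ps pt eo em => [[k [n w]] [n1 w1]] [[k' [n' w']] [n1' w1']] /= <- _ _ [e l] [e1 l1].
case: k => [|[|k]] pt ps; split => //; exists p, q; split => //=; split => //; try lia.
all: by move: e e1 l l1 {pt ps}; rewrite ?Z.mul_add_distr_l !Z.mul_assoc !(Z.mul_comm _ a) -!Z.mul_assoc => -> ; lia.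
Qed.

Lemma cov_trans s t u : cov s t -> cov t u -> cov s u.
Proof.
move=> [ek ps pt [p [q [p0 q0 eo em]]]] [ek' _ pu [p' [q' [p0' q0' eo' em']]]].
split=> //; first by rewrite ek.
exists (p * p')%Z, (q * q')%Z; split; try exact: Z.mul_pos_pos.
  split; first by nia.
  by move: eo eo' => [_ l] [_ l']; nia.
split; first by nia.
by move: em em' => [_ l] [_ l']; nia.
Qed.

Lemma smergeC : commutative smerge.
Proof.
move=> [[k [n w]] [n1 w1]] [[k' [n' w']] [n1' w1']].
by rewrite /smerge /dmul /= addnC; congr (_, (_, _), (_, _)); lia.
Qed.

Lemma smergeA : associative smerge.
Proof.
move=> [[k [n w]] [n1 w1]] [[k' [n' w']] [n1' w1']] [[k'' [n'' w'']] [n1'' w1'']].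
by rewrite /smerge /dmul /= addnA; congr (_, (_, _), (_, _)); lia.
Qed.

Lemma smergel_rem s l : s \in l -> smergel l = smerge s (smergel (rem s l)).
Proof.
elim: l => //= t l IH; rewrite inE; case: (eqVneq s t) => [-> //|/negPf nst /= /IH ->].
by rewrite /= !smergeA (smergeC t s).
Qed.

(* The merges of the multisets of [j] states of [L]. *)
Fixpoint combos (L : seq state) (j : nat) : seq state :=
  match L with
  | [::] => if j is 0 then [:: unit_state] else [::]
  | s :: L' =>
    (fix aux j := match j with
      | 0 => [:: unit_state]
      | j'.+1 => map (smerge s) (aux j') ++ combos L' j
      end) j
  end.

Lemma combosS s L j :
  combos (s :: L) j.+1 = map (smerge s) (combos (s :: L) j) ++ combos L j.+1.
Proof. by []. Qed.

(** Nested induction on the table and on [size l]: if the first state of the table occurs in [l],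
    one copy is split off; otherwise [l] lies over the rest of the table. *)
Lemma smergel_combos L l : {subset l <= L} -> smergel l \in combos L (size l).
Proof.
move ej: (size l) => j; elim: L j l ej => [|s L IHL] j l ej sub.
  case: l ej sub => [<- _|t l _ /(_ t)]; first by rewrite inE.
  by rewrite mem_head => /(_ isT).
elim: j l ej sub => [|j IHj] l ej sub; first by rewrite (size0nil ej) inE.
rewrite combosS mem_cat; have [sl|nsl] := boolP (s \in l).
  rewrite (smergel_rem sl) map_f // IHj ?size_rem ?ej // => t /mem_rem; exact: sub.
rewrite IHL ?orbT // => t tl; have := sub t tl; rewrite inE => /predU1P[ets|//].
by move: nsl; rewrite -ets tl.
Qed.

Lemma pos_combos L j : {in L, forall s, pos s} -> {in combos L j, forall s, pos s}.
Proof.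
elim: L j => [|s L IHL] j pL; first by case: j => // t; rewrite inE => /eqP ->; split.
have pL' : {in L, forall s, pos s} by move=> t tL; apply: pL; rewrite inE tL orbT.
elim: j => [|j IHj] t; first by rewrite inE => /eqP ->; split.
rewrite combosS mem_cat => /orP[/mapP[u uc ->]|]; last exact: IHL.
by apply: pos_smerge; [apply: pL; rewrite mem_head | apply: IHj].
Qed.

(** A cross-multiplied test for [cov s t]: same [k], same ratio of the counts of [o] and [m], and
    averages of [t] at most those of [s]. It makes [s] the state to discard. *)
Definition dom (s t : state) : bool :=
  let: (k, o, m) := s in let: (k', o', m') := t in
  [&& eqn k k', Z.eqb (o.1 * m'.1) (o'.1 * m.1),
      Z.leb (o'.2 * o.1) (o.2 * o'.1) & Z.leb (m'.2 * m.1) (m.2 * m'.1)].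

Definition insert (s : state) (l : seq state) :=
  if has (dom s) l then l else s :: filter (fun t => ~~ dom t s) l.

Definition prune := foldr insert [::].

Lemma dom_cov s t : pos s -> pos t -> dom s t -> cov s t.
Proof.
case: s t => [[k [n w]] [n1 w1]] [[k' [n' w']] [n1' w1']] ps pt /= /and4P[/eqnP ek].
move=> /Z.eqb_spec /= e /Z.leb_spec0 /= l /Z.leb_spec0 /= l1.
split=> //=; case: ps pt => /= p0 p1 [/= p0' p1'].
exists n', n; split=> //; split; try nia.
apply: (Zmult_le_reg_r _ _ n1'); first lia.
have -> : (n * w1' * n1' = (n' * n1) * w1')%Z by rewrite -e; ring.
have -> : (n' * n1 * w1' = n' * (w1' * n1))%Z by ring.
have -> : (n' * w1 * n1' = n' * (w1 * n1'))%Z by ring.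
by apply: Z.mul_le_mono_nonneg_l; lia.
Qed.

Lemma prune_sub l : {subset prune l <= l}.
Proof.
elim: l => //= s l IH t; rewrite /insert; case: ifP => _ => [/IH|].
  by rewrite inE => ->; rewrite orbT.
rewrite inE mem_filter => /orP[/eqP->|/andP[_ /IH]]; rewrite inE ?eqxx // => ->.
by rewrite orbT.
Qed.

Lemma prune_cov l : {in l, forall s, pos s} ->
  forall s, s \in l -> exists2 t, t \in prune l & cov s t.
Proof.
elim: l => //= s l IH pl u.
have ps : pos s by apply: pl; rewrite mem_head.
have pl' : {in l, forall s, pos s} by move=> t tL; apply: pl; rewrite inE tL orbT.
have pp t : t \in prune l -> pos t by move/prune_sub/pl'.
rewrite /insert; case: hasP => [[t tl st]|_].
  rewrite inE => /predU1P[->|/(IH pl') //]; exists t => //; apply: dom_cov => //; exact: pp.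
rewrite inE => /predU1P[->|/(IH pl') [t tl ut]].
  by exists s; rewrite ?mem_head //; apply: cov_refl.
have [ts|nts] := boolP (dom t s).
  by exists s; rewrite ?mem_head //; apply: (cov_trans ut); apply: dom_cov => //; apply: pp.
by exists t; rewrite // inE mem_filter nts tl orbT.
Qed.

(* A vertex of the last layer may be missing, which gives [unit_state]. *)
Fixpoint table (d : nat) (l : seq N) : seq state :=
  match l with
  | [::] => [:: unit_state]
  | a :: l' =>
    let t := prune (map (vtx (Z.of_N a)) (combos (table d l') d.-1)) in
    if l' is [::] then unit_state :: t else t
  end.

Lemma pos_table d l : {in table d l, forall s, pos s}.
Proof.
elim: l => [s|a l IH s]; first by rewrite inE => /eqP ->; split.
suff H : s \in prune (map (vtx (Z.of_N a)) (combos (table d l) d.-1)) -> pos s.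
  case: l {IH} H => [|b l] H //.
  by rewrite [table _ _]/= inE => /predU1P[->|/H //]; split.
by move/prune_sub/mapP => [t tc ->]; apply: pos_vtx; apply: pos_combos tc.
Qed.

Lemma cov_smergel (L ss : seq state) :
  (forall s, s \in ss -> exists2 t, t \in L & cov s t) ->
  exists ts, [/\ size ts = size ss, {subset ts <= L} & cov (smergel ss) (smergel ts)].
Proof.
elim: ss => [_|s ss IH H]; first by exists [::]; split=> //; apply: cov_unit.
have [t tL st] := H s (mem_head _ _).
have [u us|ts [sz sub c]] := IH; first by apply: H; rewrite inE us orbT.
exists (t :: ts); split; rewrite /= ?sz //; last exact: cov_smerge.
by move=> u; rewrite inE => /predU1P[-> //|/sub].
Qed.

Lemma table_cov d a l ss : size ss = d.-1 ->
  (forall s, s \in ss -> exists2 t, t \in table d l & cov s t) ->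
  exists2 t, t \in table d (a :: l) & cov (vtx (Z.of_N a) (smergel ss)) t.
Proof.
move=> sz /cov_smergel[ts [szt sub c]].
have [t tp ct] : exists2 t, t \in prune (map (vtx (Z.of_N a)) (combos (table d l) d.-1)) &
    cov (vtx (Z.of_N a) (smergel ts)) t.
  apply: prune_cov; last by rewrite map_f // -sz -szt smergel_combos.
  move=> s /mapP[u uc ->]; apply: pos_vtx; apply: pos_combos uc; exact: pos_table.
exists t; last by apply: cov_trans ct; apply: cov_vtx.
by case: l tp {sub ct} => [|b l] tp //; rewrite [table _ _]/= inE tp orbT.
Qed.

Lemma unit_table d a : unit_state \in table d [:: a].
Proof. by rewrite [table _ _]/= mem_head. Qed.

(** * Checking the forests around a root *)

Definition good (D a : Z) (s : state) : bool :=
  let: (_, _, m) := vtx a s in Z.leb (D * m.1) m.2.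

(** [good] asks for an average weight of at least [D] after a root of weight [a] is added; [t],
    having the smaller averages, is the harder case. *)
Lemma good_cov D a s t : cov s t -> good D a t -> good D a s.
Proof.
move=> /(cov_vtx a); rewrite /good.
case: (vtx a s) (vtx a t) => [[k [n w]] [n1 w1]] [[k' [n' w']] [n1' w1']].
move=> [_ _ _ [p [q [/= p0 q0 _ [e l]]]]] /Z.leb_spec0 /= h; apply/Z.leb_spec0 => /=.
apply: (Zmult_le_reg_r _ _ p); first lia.
have -> : (D * n1 * p = D * (p * n1))%Z by ring.
rewrite e; nia.
Qed.

(* The edge [uv] is rooted at [v]: the branch of [u] is one layer deeper than the
   [d - 1] other branches. *)
Definition edge_root_check (d : nat) (D : Z) (l : seq N) : bool :=
  all (fun t => all (fun s => good D (Z.of_N (head 0%num l)) (smerge t s))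
    (combos (table d (behead l)) d.-1)) (table d l).

Definition is_k (k : nat) (s : state) := eqn s.1.1 k.

(* [good D a (smerge p q)] for [p] with [k = 1] and [q] with [k = 0], written as a
   linear form in [p] whose coefficients are computed once for each [q]. *)
Definition one_check (D a : Z) (q : state) : state -> bool :=
  let: (_, o, m) := q in
  let x := (o.2 + (a - D) * o.1)%Z in
  let y := (m.2 - D * m.1)%Z in
  fun p => let: (_, o', m') := p in
  Z.leb 0 (o'.1 * x + o'.2 * o.1 + (m'.1 * y + m'.2 * m.1)).

(* The average weights of the states with [k = 1] are at least [mp], and those of
   all states at least [mq]; this settles the merges with [k >= 2]. *)
Definition vertex_root_check (d : nat) (D a mp mq : Z) (L : seq state) : bool :=
  let P := filter (is_k 1) L in let Q := filter (is_k 0) L in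
  [&& all (fun s => is_k 0 s || is_k 1 s) L,
      all (fun s => Z.leb ((D - a) * s.1.2.1) (Z.of_nat d * s.1.2.2)) Q,
      all (fun s => Z.leb (mp * s.2.1) s.2.2) P,
      all (fun s => Z.leb (mq * s.2.1) s.2.2) L,
      Z.leb mq mp, Z.leb D (2 * mp + (Z.of_nat d - 2) * mq) &
      all (fun q => all (one_check D a q) P) (combos Q d.-1)].

Lemma pos_smergel ss : {in ss, forall s, pos s} -> pos (smergel ss).
Proof.
elim: ss => [_|s ss IH ps] /=; first by split.
apply: pos_smerge; first by apply: ps; rewrite mem_head.
by apply: IH => t ts; apply: ps; rewrite inE ts orbT.
Qed.

Lemma smergel_k0 ss : all (is_k 0) ss -> (smergel ss).1.1 = 0.
Proof.
elim: ss => //= s ss IH /andP[/eqnP s0 /IH].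
by case: s (smergel ss) s0 => [[k ?] ?] [[k' ?] ?] /= -> ->.
Qed.

Lemma smerge_avg_M s t (b b' : Z) : pos s -> pos t ->
  (b * s.2.1 <= s.2.2)%Z -> (b' * t.2.1 <= t.2.2)%Z ->
  ((b + b') * (smerge s t).2.1 <= (smerge s t).2.2)%Z.
Proof.
case: s t => [[k o] [n w]] [[k' o'] [n' w']] [_ /= ?] [_ /= ?]; nia.
Qed.

Lemma smerge_avg_O s t (e b b' : Z) : pos s -> pos t ->
  (b * s.1.2.1 <= e * s.1.2.2)%Z -> (b' * t.1.2.1 <= e * t.1.2.2)%Z ->
  ((b + b') * (smerge s t).1.2.1 <= e * (smerge s t).1.2.2)%Z.
Proof.
case: s t => [[k [n w]] m] [[k' [n' w']] m'] [/= ? _] [/= ? _]; nia.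
Qed.

Lemma Z_of_natS n : Z.of_nat n.+1 = (1 + Z.of_nat n)%Z.
Proof. lia. Qed.

Lemma vertex_root_checkP d D a mp mq L ts : 0 < d ->
  vertex_root_check d D a mp mq L -> {in L, forall s, pos s} ->
  size ts = d -> {subset ts <= L} -> good D a (smergel ts).
Proof.
move=> d0 /and5P[/allP k01 /allP c0 /allP cP /allP cL /and3P[/Z.leb_spec0 mqp /Z.leb_spec0 cD /allP c1]] pL sz sub.
have pts : {in ts, forall s, pos s} by move=> s /sub/pL.
have [/hasP[p pts1 kp]|no1] := boolP (has (is_k 1) ts); last first.
  have ts0 : all (is_k 0) ts.
    apply/allP => s sts; have /orP[//|s1] := k01 s (sub s sts).
    by case/negP: no1; apply/hasP; exists s.
  have : ((Z.of_nat (size ts) * (D - a)) * (smergel ts).1.2.1 <= Z.of_nat d * (smergel ts).1.2.2)%Z.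
    elim: (ts) ts0 sub pts => [_ _ _|s l IH /andP[s0 l0] sub ps]; first by rewrite /=; lia.
    have pl : {in l, forall s, pos s} by move=> t tl; apply: ps; rewrite inE tl orbT.
    have -> : Z.of_nat (size (s :: l)) = (1 + Z.of_nat (size l))%Z by apply: Z_of_natS.
    rewrite [((1 + _) * (D - a))%Z]Z.mul_add_distr_r Z.mul_1_l.
    apply: smerge_avg_O; [by apply: ps; rewrite mem_head | exact: pos_smergel | |].
      by apply/Z.leb_spec0/c0; rewrite mem_filter s0 sub ?mem_head.
    by apply: IH => // t tl; apply: sub; rewrite inE tl orbT.
  have := smergel_k0 ts0; case: (smergel ts) => [[k [n w]] [n1 w1]] /= ->.
  rewrite sz /good /= => h; apply/Z.leb_spec0 => /=; nia.
rewrite (smergel_rem pts1); set r := rem p ts.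
have szr : size r = d.-1 by rewrite size_rem // sz.
have subr : {subset r <= ts} by move=> s; apply: mem_rem.
have pr : {in r, forall s, pos s} by move=> s /subr/pts.
have [/hasP[p' pr1 kp']|no1] := boolP (has (is_k 1) r); last first.
  have ts0 : all (is_k 0) r.
    apply/allP => s sr; have /orP[//|s1] := k01 s (sub s (subr s sr)).
    by case/negP: no1; apply/hasP; exists s.
  have rQ : smergel r \in combos (filter (is_k 0) L) d.-1.
    rewrite -szr; apply: smergel_combos => s sr; rewrite mem_filter (allP ts0) //=.
    exact/sub/subr.
  have /allP/(_ p) := c1 _ rQ; rewrite mem_filter kp sub // => /(_ isT).
  have := smergel_k0 ts0; move: kp; rewrite /good /one_check.
  case: (smergel r) (p) => [[k [n w]] [n1 w1]] [[k' [n' w']] [n1' w1']] /= /eqnP /= -> ->.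
  by move=> /Z.leb_spec0 h; apply/Z.leb_spec0 => /=; lia.
have b_r l : {subset l <= L} ->
    (Z.of_nat (size l) * mq * (smergel l).2.1 <= (smergel l).2.2)%Z.
  elim: l => [|s l IH] subl; first by rewrite /=; lia.
  have -> : Z.of_nat (size (s :: l)) = (1 + Z.of_nat (size l))%Z by apply: Z_of_natS.
  rewrite [((1 + _) * mq)%Z]Z.mul_add_distr_r Z.mul_1_l.
  have subl' : {subset l <= L} by move=> t tl; apply: subl; rewrite inE tl orbT.
  apply: smerge_avg_M; last exact: IH.
  - by apply: pL; apply: subl; rewrite mem_head.
  - by apply: pos_smergel => t /subl'/pL.
  by apply/Z.leb_spec0/cL; rewrite subl ?mem_head.
rewrite (smergel_rem pr1); set r' := rem p' r.
have szr' : size r' = d.-2 by rewrite size_rem // szr.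
have d2 : 1 < d by move: szr pr1; case: (r) => // ? ?; case: (d) => [|[]].
have subr' : {subset r' <= L} by move=> s /mem_rem/subr/sub.
have pp' : pos p' by apply: pr.
have pr' : pos (smergel r') by apply: pos_smergel => t /subr'/pL.
have pP s : is_k 1 s -> s \in ts -> (mp * s.2.1 <= s.2.2)%Z.
  by move=> ks sts; apply/Z.leb_spec0/cP; rewrite mem_filter ks sub.
have B : ((mp + (mp + Z.of_nat (size r') * mq)) * (smerge p (smerge p' (smergel r'))).2.1
    <= (smerge p (smerge p' (smergel r'))).2.2)%Z.
  apply: smerge_avg_M; [exact: pts|exact: pos_smerge|exact: pP|].
  apply: smerge_avg_M => //; [apply: pP => //; exact: subr|exact: b_r].
have : pos (smerge p (smerge p' (smergel r'))) by apply: pos_smerge; [apply: pts|apply: pos_smerge].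
move: B kp kp'; rewrite szr' /good /is_k.
case: (smergel r') (p) (p') => [[k0 o0] m0] [[k1 o1] m1] [[k2 o2] m2] B /= /eqnP -> /eqnP -> [_ /= pm].
apply/Z.leb_spec0 => /=; apply: Z.le_trans B; apply: Z.mul_le_mono_nonneg_r => /=; first lia.
suff -> : (Z.of_nat d.-2 = Z.of_nat d - 2)%Z by lia.
lia.
Qed.

(** * Branches of a graph of large girth *)

Definition girth_geq (g : nat) (G : sgraph) : Prop :=
  forall c : seq G, is_cycle c -> g <= size c.

Section Branches.

Variables (G : sgraph) (g : nat).
Hypothesis girthG : girth_geq g G.
Implicit Types (u c x y z : G) (p q t : seq G) (A : {set G}).

Fixpoint nbwalk x y p : bool :=
  edge x y && (if p is z :: p' then (z != x) && nbwalk y z p' else true).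

Lemma nbwalk_path x y p : nbwalk x y p -> path (@edge G) x (y :: p).
Proof.
by elim: p x y => [|z p IH] x y /=; [rewrite andbT | move=> /and3P[-> _ /IH]].
Qed.

Lemma no_short_cycle x y p :
  path (@edge G) x (y :: p) -> edge (last y p) x -> uniq (x :: y :: p) ->
  0 < size p -> (size p).+2 < g -> False.
Proof.
move=> pth cl un p0; rewrite ltnNge => /negP; apply.
apply: (@girthG (x :: y :: p)); split; first by rewrite /=; lia.
by rewrite /ucycle un andbT /path.cycle rcons_path cl andbT.
Qed.

(** The tail is a path by induction. If [x] came back, the walk up to its first return would be a
    cycle shorter than [g]; it has length at least 3 because the walk does not backtrack. *)
Lemma nbwalk_uniq x y p : nbwalk x y p -> (size p).+1 < g -> uniq (x :: y :: p).
Proof.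
elim: p x y => [|z p IH] x y.
  rewrite /= andbT inE andbT => exy _; apply: contraTneq exy => ->.
  by rewrite edge_irrefl.
move=> w lt; have /= /and3P[exy nzx w'] := w.
have un := IH _ _ w' (ltnW lt).
apply/andP; split=> //; apply/negP; rewrite inE => /predU1P[exy'|xin].
  by move: exy; rewrite exy' edge_irrefl.
have [q1 [q2 eq]] : exists q1 q2, z :: p = q1 ++ x :: q2.
  by case/splitPr: xin => q1 q2; exists q1, q2.
case: q1 eq => [[ezx _]|z' q1 eq]; first by move: nzx; rewrite ezx eqxx.
have := nbwalk_path w; rewrite eq -cat_cons cat_path => /andP[pth /andP[cl _]].
apply: (@no_short_cycle x y (z' :: q1)) => //.
  move: un; rewrite eq -cat_cons cat_uniq => /and3P[un1 /hasPn nin _].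
  by apply/andP; split=> //; apply: nin; rewrite mem_head.
by move: lt; rewrite eq size_cat /=; lia.
Qed.

Definition kids u c : seq G := [seq x <- enum G | edge c x && (x != u)].

Definition nbrs c : seq G := [seq x <- enum G | edge c x].

Lemma mem_kids u c x : (x \in kids u c) = edge c x && (x != u).
Proof. by rewrite mem_filter mem_enum andbT. Qed.

Lemma mem_nbrs c x : (x \in nbrs c) = edge c x.
Proof. by rewrite mem_filter mem_enum andbT. Qed.

Lemma uniq_kids u c : uniq (kids u c).
Proof. exact/filter_uniq/enum_uniq. Qed.

Lemma uniq_nbrs c : uniq (nbrs c).
Proof. exact/filter_uniq/enum_uniq. Qed.

Lemma size_nbrs c : size (nbrs c) = degree c.
Proof. by rewrite size_filter /degree cardsE cardE size_filter enumT; apply: eq_count => x; rewrite !inE. Qed.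

Lemma size_kids u c : edge u c -> size (kids u c) = (degree c).-1.
Proof.
move=> euc; rewrite -size_nbrs.
have -> : kids u c = rem u (nbrs c).
  rewrite rem_filter ?uniq_nbrs // /kids /nbrs -(filter_predI (predC1 u) (edge c)).
  by apply: eq_filter => x; rewrite /= andbC.
by rewrite size_rem // mem_nbrs edge_sym.
Qed.

(** The first [k] layers hanging from [c] on the side away from [u]: the ends of the
    non-backtracking walks that start with [u], [c] and take fewer than [k] further steps. *)
Fixpoint branch k u c : {set G} :=
  if k is k'.+1 then c |: \bigcup_(x <- kids u c) branch k' c x else set0.

Lemma in_bigcup_seq (F : G -> {set G}) (s : seq G) y :
  reflect (exists2 x, x \in s & y \in F x) (y \in \bigcup_(x <- s) F x).
Proof.
elim: s => [|x s IH]; first by rewrite big_nil inE; constructor => -[].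
rewrite big_cons; apply: (iffP setUP) => [[Fy|/IH[z zs Fz]]|[z]].
- by exists x; rewrite ?mem_head.
- by exists z; rewrite // inE zs orbT.
rewrite inE => /predU1P[->|zs]; first by left.
by right; apply/IH; exists z.
Qed.

Lemma branchS k u c y :
  reflect (y = c \/ exists x, [/\ edge c x, x != u & y \in branch k c x])
          (y \in branch k.+1 u c).
Proof.
apply: (iffP setU1P) => [[->|/in_bigcup_seq[x]]|[->|[x [cx xu yx]]]]; try by left.
  by rewrite mem_kids => /andP[cx xu] yx; right; exists x.
by right; apply/in_bigcup_seq; exists x; rewrite // mem_kids cx.
Qed.

Lemma branch_walk_to k u c y : edge u c -> y \in branch k u c ->
  exists t, [/\ nbwalk u c t, last c t = y & size t < k].
Proof.
elim: k u c => [|k IH] u c euc; first by rewrite inE.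
case/branchS => [->|[x [cx xu /(IH _ _ cx)[t [w l sz]]]]].
  by exists [::]; rewrite /= euc.
by exists (x :: t); rewrite /= euc xu l ltnS.
Qed.

(* Extends a walk leaving [c] through [u] backwards, down to the vertex [y]. *)
Lemma branch_walk_from k u c y t : nbwalk c u t -> y \in branch k u c ->
  exists z q, [/\ nbwalk y z q, last z q = last u t, size q < size t + k &
    size t + (y != c) <= size q].
Proof.
elim: k u c t => [|k IH] u c t w; first by rewrite inE.
case/branchS => [->|[x [cx xu yx]]].
  by exists u, t; split=> //; rewrite ?eqxx ?addn0 // addnS ltnS leq_addr.
have w' : nbwalk x c (u :: t) by rewrite /= edge_sym cx eq_sym xu.
have [z [q [wq lq sq q0]]] := IH _ _ _ w' yx.
by exists z, q; split=> //; move: sq q0 => /=; case: (y != c); lia.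
Qed.

(** The walk from [y] up to [c] and down to [y'] does not backtrack and has at most [k + k'] edges.
    So it is a path, and an edge between its ends would close a cycle shorter than [g]. *)
Lemma separated_branch c x x' k k' : edge c x -> edge c x' -> x != x' ->
  k + k' + 1 < g -> separated (branch k c x) (branch k' c x').
Proof.
move=> cx cx' nxx lt y y' yx /(branch_walk_to cx')[t [wt lt' st]].
have w : nbwalk x c (x' :: t) by rewrite /= edge_sym cx eq_sym nxx.
have [z [q [wq lq sq q0]]] := branch_walk_from w yx.
have un : uniq (y :: z :: q) by apply: nbwalk_uniq wq _; move: sq => /=; lia.
have ly : last z q = y' by rewrite lq -lt'.
apply/andP; split.
  apply: contraTneq un => ->; rewrite -ly /= negb_and negbK.
  by rewrite mem_last.
apply/negP => eyy; apply: (no_short_cycle (nbwalk_path wq)) => //.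
- by rewrite ly edge_sym.
- by move: q0 => /=; lia.
by move: sq => /=; lia.
Qed.

Lemma branch_adj c x y k : edge c x -> k + 1 < g -> y \in branch k c x ->
  (y != c) && (edge c y == (y == x)).
Proof.
move=> cx lt yx.
have w : nbwalk x c [::] by rewrite /= edge_sym cx.
have [z [q [wq lq sq q0]]] := branch_walk_from w yx.
have un : uniq (y :: z :: q) by apply: nbwalk_uniq wq _; move: sq => /=; lia.
apply/andP; split.
  by apply: contraTneq un => ->; rewrite -[X in X :: _]lq /= mem_last.
have [->|nyx] := eqVneq y x; first by rewrite cx.
apply/eqP/negbTE/negP => cy; apply: (no_short_cycle (nbwalk_path wq)) => //.
- by rewrite lq.
- by move: q0; rewrite nyx /=; lia.
by move: sq => /=; lia.
Qed.

(** Gives [a_i] for each non-backtracking walk of [i] steps from [c] to [y] whose first step avoids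
    [u]. When the branch is a tree there is at most one such walk; counting walks makes the total
    over all roots an exact count in [sum_wt]. *)
Fixpoint wt (l : seq N) u c y : nat :=
  if l is a :: l' then
    N.to_nat a * (y == c) + \sum_(x <- kids u c) wt l' c x y
  else 0.

Lemma wt_out l u c y : y \notin branch (size l) u c -> wt l u c y = 0.
Proof.
elim: l u c => //= a l IH u c; rewrite !inE negb_or => /andP[/negPf -> /in_bigcup_seq nin].
rewrite muln0 add0n big1_seq // => x /andP[_ xk]; apply: IH; apply/negP => yx.
by apply: nin; exists x.
Qed.

Lemma wt_kid a l u c x y : (size l).*2 + 1 < g -> edge c x -> x != u ->
  y \in branch (size l) c x -> wt (a :: l) u c y = wt l c x y.
Proof.
move=> lt cx xu yx.
have lt1 : size l + 1 < g by lia.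
have lt2 : size l + size l + 1 < g by lia.
have /andP[/negPf nyc _] := branch_adj cx lt1 yx.
rewrite /= nyc muln0 add0n.
rewrite (bigD1_seq x) ?uniq_kids ?mem_kids ?cx //= big1_seq ?addn0 // => x'.
rewrite mem_kids => /and3P[nx cx' _]; apply: wt_out; apply/negP => yx'.
by have := separated_branch cx' cx nx lt2 yx' yx; rewrite eqxx.
Qed.

Lemma wt_top a l u c : (size l).*2 + 1 < g -> wt (a :: l) u c c = N.to_nat a.
Proof.
move=> lt; rewrite /= eqxx muln1 big1_seq ?addn0 // => x /andP[_]; rewrite mem_kids => /andP[cx _].
have lt1 : size l + 1 < g by lia.
by apply: wt_out; apply/negP => /(branch_adj cx lt1); rewrite eqxx.
Qed.

Lemma setI_star c (F : G -> {set G}) s A : c \in A ->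
  (c |: \bigcup_(x <- s) F x) :&: A = c |: \bigcup_(x <- s) (F x :&: A).
Proof.
move=> cA; apply/setP => y; rewrite !inE andb_orl; congr (_ || _).
  by case: eqP => // ->.
apply/andP/in_bigcup_seq => [[/in_bigcup_seq[x xs Fx] yA]|[x xs /setIP[Fx yA]]].
  by exists x; rewrite // inE Fx.
by split=> //; apply/in_bigcup_seq; exists x.
Qed.

(** [A] will be [free J]. It contains every layer except possibly the last, so a top can be missing
    only from a branch of one layer, which gives [unit_state]; otherwise the branch is a top above
    the branches of its [d - 1] children. *)
Lemma branch_cov d l u c A (w : G -> nat) : (forall x, degree x = d) ->
  edge u c -> (size l).*2 <= g -> branch (size l).-1 u c \subset A ->
  {in branch (size l) u c, forall y, w y = wt l u c y} ->
  exists2 t, t \in table d l & cov (st w (branch (size l) u c :&: A) c) t.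
Proof.
move=> reg; elim: l u c => [|a l IH] u c euc lt sA ww.
  by exists unit_state; rewrite ?inE // set0I st_set0; apply: cov_unit.
have lt' : (size l).*2 + 1 < g by move: lt; rewrite /= doubleS; lia.
have [cA|ncA] := boolP (c \in A); last first.
  have l0 : l = [::].
    case: (l) sA => // b l' /subsetP/(_ c); rewrite (negPf ncA) => H.
    by have := H (setU11 _ _).
  exists unit_state; first by rewrite l0 unit_table.
  have -> : branch (size (a :: l)) u c :&: A = set0; last by rewrite st_set0; apply: cov_unit.
  apply/setP => y; rewrite inE in_set0 l0; apply/andP => -[/branchS[->|]]; first by rewrite (negPf ncA).
  by case=> x [_ _]; rewrite inE.
rewrite [branch _ _ _]/= setI_star // st_star ?uniq_kids //.
- rewrite ww ?setU11 // wt_top // N_nat_Z; apply: table_cov.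
    by rewrite size_map size_kids // reg.
  move=> s /mapP[x]; rewrite mem_kids => /andP[cx xu] ->; apply: IH => //.
  + by lia.
  + apply: subset_trans sA; case: (l) => [|b l' /=]; first by rewrite sub0set.
    by apply/subsetP => y yx; apply/branchS; right; exists x.
  move=> y yx; rewrite -(@wt_kid a l u) // ww //.
  by apply/branchS; right; exists x.
- move=> x x'; rewrite !mem_kids => /andP[cx _] /andP[cx' _] nxx y y' /setIP[yx _] /setIP[yx' _].
  by apply: (separated_branch cx cx' nxx _ yx yx'); lia.
move=> x; rewrite mem_kids => /andP[cx _] y /setIP[yx _].
by apply: branch_adj cx _ yx; lia.
Qed.

End Branches.

(** * Resampling *)

Section Resampling.

Variable G : sgraph.
Implicit Types (A B I J K : {set G}).

Definition free J : {set G} := [set y | [forall x in J, ~~ edge x y]].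

Lemma free_interior B J y : [disjoint B & J] -> (forall z, edge y z -> z \in B) ->
  y \in free J.
Proof.
move=> dBJ yB; rewrite inE; apply/forall_inP => x xJ; apply/negP => exy.
by move: dBJ; rewrite disjoint_sym => /disjointFr/(_ xJ); rewrite yB // edge_sym.
Qed.

Lemma independentU_free J K :
  independent (K :|: J) = [&& independent K, independent J & K \subset free J].
Proof.
apply/idP/and3P => [iKJ|[/independentP iK /independentP iJ /subsetP sK]].
  split; first by apply: independentS iKJ; apply: subsetUl.
    by apply: independentS iKJ; apply: subsetUr.
  apply/subsetP => y Ky; rewrite inE; apply/forall_inP => x Jx.
  by move/independentP: iKJ; apply; rewrite inE (Jx, Ky) ?orbT.
have free_edge x y : x \in J -> y \in K -> ~~ edge x y.
  by move=> xJ /sK; rewrite inE => /forall_inP; apply.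
apply/independentP => x y /setUP[Kx|Jx] /setUP[Ky|Jy]; [exact: iK | | exact: free_edge | exact: iJ].
by rewrite edge_sym; apply: free_edge.
Qed.

(** The maximum independent sets are grouped by [J = I :\: B]. A nonempty group consists of all
    [K :|: J] with [K] in [MI (B :&: free J)], so the local inequalities add up. *)
Lemma resample B (f : {set G} -> nat) D :
  (forall J, [disjoint B & J] ->
     D * #|MI (B :&: free J)| <= \sum_(K in MI (B :&: free J)) f (K :|: J)) ->
  D * #|MI [set: G]| <= \sum_(I in MI [set: G]) f I.
Proof.
move=> loc; rewrite card_sum_MI big_distrr /=.
rewrite (partition_big (fun I => I :\: B) predT) //=.
rewrite [X in _ <= X](partition_big (fun I => I :\: B) predT) //=.
apply: leq_sum => J _.
have [/existsP[I0 /andP[I0M /eqP eJ]]|/existsPn none] :=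
  boolP [exists I in MI [set: G], I :\: B == J]; last first.
  by rewrite big_pred0 // => I; apply/negbTE.
have dBJ : [disjoint B & J].
  by rewrite -setI_eq0 -eJ; apply/eqP/setP => x; rewrite !inE; case: (x \in B).
have eI0 : I0 = (I0 :&: B) :|: J by rewrite -eJ setID.
have [_ iI0 cI0] := MIP _ _ I0M.
have cU K : K \subset B -> #|K :|: J| = #|K| + #|J|.
  move=> sK; rewrite cardsU (_ : K :&: J = set0) ?cards0 ?subn0 //.
  by apply/eqP; rewrite setI_eq0; apply: disjointWl sK dBJ.
have iJ : independent J by move: iI0; rewrite eI0 independentU_free => /and3P[].
have sI0 : I0 :&: B \subset B := subsetIr _ _.
(* A larger set inside [B :&: free J] could replace [I0 :&: B], contradicting the maximality of
   [I0]. *)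
have mB : mis (B :&: free J) + #|J| = mis [set: G].
  apply/eqP; rewrite eqn_leq; apply/andP; split.
    have [K /MIP[sK iK <-]] := ex_MI (B :&: free J).
    move: sK; rewrite subsetI => /andP[sKB sKf].
    by rewrite -cU //; apply: leq_mis; rewrite ?subsetT // independentU_free iK iJ.
  rewrite -cI0 {1}eI0 cU // leq_add2r.
  move: iI0; rewrite {1}eI0 independentU_free => /and3P[iK _ sK].
  by apply: leq_mis; rewrite // subsetI sI0.
have bij (F : {set G} -> nat) :
    \sum_(I in MI [set: G] | I :\: B == J) F I =
    \sum_(K in MI (B :&: free J)) F (K :|: J).
  rewrite (reindex_onto (fun K => K :|: J) (fun I => I :&: B)) /=; last first.
    by move=> I /andP[_ /eqP <-]; rewrite setID.
  apply: eq_bigl => K; apply/andP/idP => [[/andP[/MIP[_ iKJ cKJ] _] /eqP eK]|].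
    have sK : K \subset B by rewrite -eK subsetIr.
    move: iKJ; rewrite independentU_free => /and3P[iK _ sKf].
    by apply/MIP; split; rewrite ?subsetI ?sK //; move: cKJ; rewrite cU // -mB; lia.
  case/MIP; rewrite subsetI => /andP[sK sKf] iK cK.
  have JB0 : J :&: B = set0 by apply/eqP; rewrite setIC setI_eq0.
  have JB : J :\: B = J by apply/setDidPl; rewrite disjoint_sym.
  split; last by rewrite setIUl JB0 setU0; apply/eqP/setIidPl.
  rewrite setDUl JB (_ : K :\: B = set0) ?set0U ?eqxx ?andbT; last by apply/eqP; rewrite setD_eq0.
  by apply/MIP; split; rewrite ?subsetT ?independentU_free ?iK ?iJ // cU // cK.
by rewrite !bij -big_distrr /= -card_sum_MI; apply: loc.
Qed.

(** The values given by all roots [t] to all maximum independent sets are summed by roots and by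
    sets; each set has size [alpha G], and the factor [#|MI setT|] cancels. *)
Lemma double_count (T : finType) (P : pred T) (f : T -> {set G} -> nat) C D :
  (forall I, I \in MI [set: G] -> \sum_(t | P t) f t I <= C * #|I|) ->
  (forall t, P t -> D * #|MI [set: G]| <= \sum_(I in MI [set: G]) f t I) ->
  D * #|P| <= C * alpha G.
Proof.
move=> glob loc.
have [I0 I0M] := ex_MI [set: G].
have M0 : 0 < #|MI [set: G]| by apply/card_gt0P; exists I0.
rewrite -(leq_pmul2r M0).
have : \sum_(t | P t) D * #|MI [set: G]| <= \sum_(t | P t) \sum_(I in MI [set: G]) f t I.
  exact: leq_sum.
rewrite sum_nat_const exchange_big /= => le1.
have : \sum_(I in MI [set: G]) \sum_(t | P t) f t I <= \sum_(I in MI [set: G]) C * alpha G.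
  apply: leq_sum => I IM; apply: leq_trans (glob I IM) _.
  by have [_ _ ->] := MIP _ _ IM; rewrite mis_alpha.
rewrite sum_nat_const => le2; have := leq_trans le1 le2.
by rewrite mulnCA mulnA [X in _ <= X -> _]mulnC.
Qed.

End Resampling.

(** * Balls around the vertices and the edges of a regular graph *)

Fixpoint flow (d : nat) (l : seq N) : N :=
  if l is a :: l' then (N.of_nat d * a + N.of_nat d.-1 * flow d l')%num else 0%num.

Lemma flow_cons d a l :
  N.to_nat (flow d (a :: l)) = d * N.to_nat a + d.-1 * N.to_nat (flow d l).
Proof. by rewrite /= N2Nat.inj_add !N2Nat.inj_mul !Nat2N.id. Qed.

Section RegularGraphs.

Variables (G : sgraph) (g d : nat).
Hypothesis girthG : girth_geq g G.
Hypothesis regG : forall x : G, degree x = d.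
Implicit Types (u v c x y z : G) (A B I J K : {set G}).

Lemma sum_kids u c (F : G -> nat) :
  \sum_(x <- kids u c) F x = \sum_(x | edge c x && (x != u)) F x.
Proof. by rewrite big_filter big_enum_cond. Qed.

Lemma sum_nbrs c (F : G -> nat) : \sum_(x <- nbrs c) F x = \sum_(x | edge c x) F x.
Proof. by rewrite big_filter big_enum_cond. Qed.

Lemma card_edge c : #|[pred x | edge c x]| = d.
Proof. by rewrite -(regG c) /degree cardsE. Qed.

(** Over all oriented edges [u c], exactly [d (d - 1)^i] non-backtracking walks reach [x] in [i]
    steps from [c], since each oriented edge [c y] can be preceded by [d - 1] vertices [u]. Thus
    [flow] is the sum of the [d (d - 1)^i a_i]. *)
Lemma sum_wt l x : \sum_u \sum_(c | edge u c) wt l u c x = N.to_nat (flow d l).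
Proof.
elim: l => [|a l IH]; first by rewrite big1 // => u _; rewrite big1.
rewrite flow_cons [LHS]/=.
under eq_bigr => u _ do rewrite big_split /=.
rewrite big_split /=; congr (_ + _).
  rewrite (exchange_big_dep predT) //= (bigD1 x) //= [X in _ + X]big1 ?addn0.
    under eq_bigl => u do rewrite edge_sym.
    by rewrite sum_nat_const card_edge eqxx muln1.
  by move=> c nx; rewrite eq_sym (negPf nx) big1 // => u _; rewrite muln0.
rewrite -IH big_distrr /= (exchange_big_dep predT) //=; apply: eq_bigr => c _.
under eq_bigr => u _ do rewrite sum_kids.
rewrite (exchange_big_dep (edge c)) /=; last by move=> u y _ /andP[].
rewrite big_distrr /=; apply: eq_bigr => y cy; rewrite sum_nat_const; congr (_ * _).
have -> : #|[pred u | edge u c && (edge c y && (y != u))]| = #|[pred u | edge c u]|.-1.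
  rewrite (cardD1 y [pred u | edge c u]) inE cy add1n /=; apply: eq_card => u.
  by rewrite !inE /= edge_sym andbC eq_sym.
by rewrite card_edge.
Qed.

Lemma branch_nbr k u c y z : y \in branch k u c -> edge y z ->
  z = u \/ z \in branch k.+1 u c.
Proof.
elim: k u c => [|k IH] u c; first by rewrite inE.
case/branchS => [->|[x [cx xu /IH/[apply]]]].
  move=> cz; have [->|zu] := eqVneq z u; [by left | right].
  by apply/branchS; right; exists z; split=> //; apply/branchS; left.
case=> [->|zx]; right; apply/branchS; first by left.
by right; exists x.
Qed.

Lemma opt_good (w : G -> nat) (D a0 : N) T (S_ : G -> {set G}) cs v :
  T = v |: \bigcup_(x <- cs) S_ x -> w v = N.to_nat a0 ->
  uniq cs -> {in cs &, forall x y, x != y -> separated (S_ x) (S_ y)} ->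
  {in cs, forall x, {in S_ x, forall y, (y != v) && (edge v y == (y == x))}} ->
  good (Z.of_N D) (Z.of_N a0) (smergel [seq st w (S_ x) x | x <- cs]) ->
  N.to_nat D * #|MI T| <= \sum_(K in MI T) \sum_(x in K) w x.
Proof.
move=> eT wv ucs sep adj; have := st_star w ucs sep adj.
rewrite -eT wv N_nat_Z /good => <-; rewrite /st /opt /= => /Z.leb_spec0 /=; lia.
Qed.

Lemma leq_sum_setU (w : G -> nat) K J :
  \sum_(x in K) w x <= \sum_(x in K :|: J) w x.
Proof.
rewrite [X in _ <= X](bigID (mem K)) /= [X in _ <= X + _](eq_bigl (mem K)) ?leq_addr // => x.
by rewrite !inE /=; case: (x \in K); rewrite ?andbF.
Qed.

Lemma ball_disjoint_free J v (S_ : G -> {set G}) cs y :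
  [disjoint v |: \bigcup_(x <- cs) S_ x & J] ->
  (forall z, edge y z -> z = v \/ exists2 x, x \in cs & z \in S_ x) -> y \in free J.
Proof.
move=> dis H; apply: (free_interior dis) => z /H[->|[x xs zx]]; first exact: setU11.
by apply/setU1P; right; apply/in_bigcup_seq; exists x.
Qed.

Lemma vertex_bound (D a0 : N) l mp mq : 0 < d -> 0 < size l -> (size l).*2.+1 < g ->
  vertex_root_check d (Z.of_N D) (Z.of_N a0) mp mq (table d l) ->
  N.to_nat D * #|G| <= N.to_nat (a0 + flow d l) * alpha G.
Proof.
move=> d0 l0 lt chk.
have lt1 : size l + size l + 1 < g by lia.
have lt2 : size l + 1 < g by lia.
(* [a0] at the root and the weights of [l] layer by layer: a vertex of [I] collects [a0] from itself
   as a root and [flow d l] from the branches. *)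
pose W v x := N.to_nat a0 * (x == v) + \sum_(c <- nbrs v) wt l v c x.
apply: (double_count (f := fun v I => \sum_(x in I) W v x)) => [I _|v _].
  have -> : N.to_nat (a0 + flow d l) = N.to_nat a0 + N.to_nat (flow d l) by lia.
  rewrite exchange_big /= mulnC -sum_nat_const; apply: leq_sum => x _.
  rewrite big_split /= (bigD1 x) //= eqxx muln1 big1 => [|v nvx].
    rewrite addn0 leq_add2l -(sum_wt l x).
    by under [X in _ <= X]eq_bigr => v _ do rewrite -sum_nbrs.
  by rewrite eq_sym (negPf nvx) muln0.
apply: (@resample _ (v |: \bigcup_(c <- nbrs v) branch (size l) v c)) => J dis.
have vf : v \in free J.
  apply: (ball_disjoint_free dis) => z vz; right; exists z; rewrite ?mem_nbrs //.
  by case: (size l) l0 => // k _; apply/branchS; left.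
have sub c : edge v c -> branch (size l).-1 v c \subset free J.
  move=> vc; apply/subsetP => y yc; apply: (ball_disjoint_free dis) => z yz.
  have [->|zc] := branch_nbr yc yz; first by left.
  by right; exists c; rewrite ?mem_nbrs //; move: zc; rewrite prednK.
have Wc c y : edge v c -> y \in branch (size l) v c -> W v y = wt l v c y.
  move=> vc yc; have /andP[/negPf nyv _] := branch_adj girthG vc lt2 yc.
  rewrite /W nyv muln0 (bigD1_seq c) ?uniq_nbrs ?mem_nbrs //= big1_seq ?addn0 // => c'.
  rewrite mem_nbrs => /andP[nc vc']; apply: wt_out; apply/negP => yc'.
  by have := separated_branch girthG vc' vc nc lt1 yc' yc; rewrite eqxx.
have Wv : W v v = N.to_nat a0.
  rewrite /W eqxx muln1 big1_seq ?addn0 // => c /andP[_]; rewrite mem_nbrs => vc.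
  by apply: wt_out; apply/negP => /(branch_adj girthG vc lt2); rewrite eqxx.
apply: leq_trans (_ : \sum_(K in MI ((v |: \bigcup_(c <- nbrs v) branch (size l) v c) :&: free J)) \sum_(x in K) W v x <= _); last first.
  by apply: leq_sum => K _; apply: leq_sum_setU.
apply: (opt_good (setI_star _ _ vf) Wv (uniq_nbrs v)).
- move=> x y; rewrite !mem_nbrs => vx vy nxy a b /setIP[ax _] /setIP[bx _].
  exact: (separated_branch girthG vx vy nxy lt1 ax bx).
- move=> x; rewrite mem_nbrs => vx y /setIP[yx _]; exact: (branch_adj girthG vx lt2 yx).
have [s|ts [szt subt c]] := @cov_smergel (table d l) [seq st (W v) (branch (size l) v x :&: free J) x | x <- nbrs v].
  case/mapP => x; rewrite mem_nbrs => vx ->.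
  by apply: (branch_cov girthG) => //; [lia | exact: sub | move=> y; apply: Wc].
apply: good_cov c _; apply: vertex_root_checkP chk _ _ subt => //; first exact: pos_table.
by rewrite szt size_map size_nbrs regG.
Qed.

(** The roots are the [d * #|G|] oriented edges. The weights start with [a0] at both ends of the
    edge, so a vertex of [I] collects [flow d (a0 :: l)] twice, once for each end. *)
Lemma edge_bound (D a0 : N) l : 0 < d -> 0 < size l -> (size l).*2.+2 < g ->
  edge_root_check d (Z.of_N D) (a0 :: l) ->
  N.to_nat D * (d * #|G|) <= 2 * N.to_nat (flow d (a0 :: l)) * alpha G.
Proof.
move=> d0 l0 lt /allP chk; set r := size l in l0 lt.
have lt1 : r + r + 1 < g by lia.
have lt2 : r + 1 < g by lia.
have lt3 : r.+1 + r + 1 < g by lia.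
have lt4 : r.+1 + 1 < g by lia.
have lt5 : r.*2 + 1 < g by lia.
pose W (e : G * G) x := wt (a0 :: l) e.1 e.2 x + wt (a0 :: l) e.2 e.1 x.
have -> : d * #|G| = #|[pred e : G * G | edge e.1 e.2]|.
  rewrite -[RHS]sum1_card (eq_bigl (fun e : G * G => predT e.1 && edge e.1 e.2)) //.
  rewrite -(pair_big_dep predT (fun u c => edge u c) (fun _ _ => 1)) /= mulnC.
  by under eq_bigr => u _ do rewrite sum1_card card_edge; rewrite sum_nat_const.
set F := N.to_nat (flow d (a0 :: l)); have sumF x : F = _ := esym (sum_wt (a0 :: l) x).
apply: (double_count (f := fun e I => \sum_(x in I) W e x)) => [I _|[v u] /= vu].
  rewrite exchange_big /= mulnC -sum_nat_const; apply: leq_sum => x _.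
  rewrite big_split /= mul2n -addnn; apply: leq_add; rewrite (sumF x).
    by rewrite pair_big_dep.
  by rewrite (exchange_big_dep predT) //= pair_big_dep /=; apply: eq_leq; apply: eq_bigl => -[c e]; rewrite /= edge_sym.
have uv : edge u v by rewrite edge_sym.
pose S_ x := if x == u then branch r.+1 v u else branch r v x.
pose cs := u :: kids u v.
have uk : u \notin kids u v by rewrite mem_kids eqxx andbF.
have csP x : x \in cs -> edge v x.
  by rewrite inE mem_kids => /predU1P[->|/andP[]].
have csP' x : x \in cs -> x != u -> x \in kids u v.
  by rewrite inE => /predU1P[->|//]; rewrite eqxx.
have ucs : uniq cs by rewrite /= uk uniq_kids.
have adj : {in cs, forall x, {in S_ x, forall y, (y != v) && (edge v y == (y == x))}}.
  move=> x /csP vx y; rewrite /S_; case: (eqVneq x u) => [exu|_] yx.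
    by rewrite exu; apply: (branch_adj girthG vu lt4 yx).
  exact: (branch_adj girthG vx lt2 yx).
have sep : {in cs &, forall x y, x != y -> separated (S_ x) (S_ y)}.
  move=> x y xcs ycs nxy; rewrite /S_; case: (eqVneq x u) => [exu|nxu].
    rewrite eq_sym -exu (negPf nxy) exu; apply: (separated_branch girthG) => //.
    - exact: csP.
    - by rewrite -exu.
  case: (eqVneq y u) => [eyu|nyu].
    by apply: (separated_branch girthG (csP _ xcs) vu nxu); lia.
  by apply: (separated_branch girthG) => //; apply: csP.
apply: (@resample _ (v |: \bigcup_(c <- cs) S_ c)) => J dis.
have ucs' : u \in cs by rewrite mem_head.
have vf : v \in free J.
  apply: (ball_disjoint_free dis) => z vz; right; exists z.
    by rewrite inE mem_kids vz /=; case: eqP.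
  rewrite /S_; case: eqP => [->|_]; first by apply/branchS; left.
  by case: (r) l0 => // k _; apply/branchS; left.
have subu : branch r v u \subset free J.
  apply/subsetP => y yu; apply: (ball_disjoint_free dis) => z yz.
  have [->|zu] := branch_nbr yu yz; [by left | right].
  by exists u; rewrite // /S_ eqxx.
have subx x : x \in kids u v -> branch r.-1 v x \subset free J.
  move=> xk; apply/subsetP => y yx; apply: (ball_disjoint_free dis) => z yz.
  have [->|zx] := branch_nbr yx yz; [by left | right].
  exists x; first by rewrite inE xk orbT.
  move: xk; rewrite mem_kids /S_ => /andP[_ /negPf ->]; by move: zx; rewrite prednK.
have Wv : W (v, u) v = N.to_nat a0.
  have -> : W (v, u) v = wt (a0 :: l) v u v + wt (a0 :: l) u v v by [].
  rewrite (wt_top girthG a0 u v lt5) wt_out //.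
  by apply/negP => /(branch_adj girthG vu lt4); rewrite eqxx.
have Wu y : y \in branch r.+1 v u -> W (v, u) y = wt (a0 :: l) v u y.
  move=> yu; have -> : W (v, u) y = wt (a0 :: l) v u y + wt (a0 :: l) u v y by [].
  rewrite [X in _ + X](_ : _ = 0) ?addn0 //; apply: wt_out; apply/negP => /branchS[eyv|[x [vx xu yx]]].
    by move: (branch_adj girthG vu lt4 yu); rewrite eyv eqxx.
  by have := separated_branch girthG vu vx (_ : u != x) lt3 yu yx; rewrite eq_sym eqxx => /(_ xu).
have Wx x y : x \in kids u v -> y \in branch r v x -> W (v, u) y = wt l v x y.
  rewrite mem_kids => /andP[vx xu] yx.
  have -> : W (v, u) y = wt (a0 :: l) v u y + wt (a0 :: l) u v y by [].
  rewrite (wt_kid girthG a0 lt5 vx xu yx) wt_out ?add0n //; apply/negP => yu.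
  by have := separated_branch girthG vu vx (_ : u != x) lt3 yu yx; rewrite eq_sym eqxx => /(_ xu).
apply: leq_trans (_ : \sum_(K in MI ((v |: \bigcup_(c <- cs) S_ c) :&: free J)) \sum_(x in K) W (v, u) x <= _); last first.
  by apply: leq_sum => K _; apply: leq_sum_setU.
apply: (opt_good (setI_star _ _ vf) Wv ucs).
- by move=> x y xcs ycs nxy a b /setIP[ax _] /setIP[bx _]; apply: (sep x y).
- by move=> x xcs y /setIP[yx _]; apply: adj yx.
have [t tT ct] : exists2 t, t \in table d (a0 :: l) & cov (st (W (v, u)) (S_ u :&: free J) u) t.
  rewrite /S_ eqxx; apply: (branch_cov girthG) => //; first by rewrite /= -/r; lia.
have [s|ts [szt subt c]] := @cov_smergel (table d l) [seq st (W (v, u)) (S_ x :&: free J) x | x <- kids u v].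
  case/mapP => x xk ->; have := xk; rewrite mem_kids => /andP[vx xu].
  rewrite /S_ (negPf xu); apply: (branch_cov girthG) => //; [by rewrite -/r; lia | exact: subx | move=> y; exact: Wx].
rewrite /=; apply: (good_cov (cov_smerge ct c)).
move/allP: (chk t tT); apply.
have <- : size ts = d.-1 by rewrite szt size_map size_kids // regG.
exact: smergel_combos.
Qed.

End RegularGraphs.

(** * Private neighbours *)

(* The branches of depth 2 with no, one, or more available leaves; only in the
   first case the root is the only possible neighbour of the child in [I]. *)
Definition private_states (a b : nat) : seq state :=
  [:: (1, (1, 0)%Z, (1, Z.of_nat a)%Z);
      (0, (1, 0)%Z, (2, Z.of_nat (a - b))%Z);
      (0, (1, 0)%Z, (1, 0)%Z)].

(** [k = 0] means that every child of the root has an available leaf; then no child is sure to be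
    private to the root, whose weight is only [D]. *)
Definition private_check (d D a b : nat) : bool :=
  all (fun s => good (Z.of_nat D) (Z.of_nat (D + b * d.-1)) s &&
                (is_k 0 s ==> good (Z.of_nat D) (Z.of_nat D) s))
    (combos (private_states a b) d).

Section PrivateNeighbours.

Variables (G : sgraph) (d D a b : nat).
Hypothesis girthG : girth_geq 6 G.
Hypothesis regG : forall x : G, degree x = d.
Hypothesis le_ba : b <= a.
Implicit Types (u v c x y z : G) (A B I J K : {set G}).

Definition private I x y : bool :=
  edge x y && [forall z in I, edge y z ==> (z == x)].

(* A vertex of [I] with a private neighbour [y] gains [b (d - 1)] as the root, and
   loses [b] for each of the [d - 1] roots adjacent to it other than [y]. *)
Definition priv_val I v : nat :=
  (v \in I) * (D + b * d.-1 * [exists y, private I v y]) +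
  \sum_(c in I | edge v c) (a - b * [exists y, (y != v) && private I c y]).

Lemma sum_priv_val I : \sum_v priv_val I v <= (D + d * a) * #|I|.
Proof.
rewrite /priv_val big_split /=.
rewrite [X in X + _](bigID (mem I)) /= [X in _ + X + _]big1 ?addn0; last first.
  by move=> v nvI; rewrite (negPf (nvI : v \notin I)).
rewrite (exchange_big_dep (mem I)) /=; last by move=> v c _ /andP[].
rewrite -big_split [X in _ <= X]mulnC -sum_nat_const; apply: leq_sum => x xI /=.
rewrite (_ : x \in I) // mul1n.
have [/existsP[y xy]|noy] := boolP [exists y, private I x y]; last first.
  rewrite muln0 addn0 leq_add2l; apply: leq_trans (_ : \sum_(v | edge x v) a <= _).
    under [X in _ <= X]eq_bigl => v do rewrite edge_sym.
    by apply: leq_sum => v _; rewrite leq_subr.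
  by rewrite sum_nat_const (card_edge regG) mulnC.
have /andP[exy _] := xy.
rewrite muln1 (bigD1 y) /=; last by rewrite edge_sym.
have le1 : \sum_(v | edge v x && (v != y)) (a - b * [exists y0, (y0 != v) && private I x y0])
    <= d.-1 * (a - b).
  apply: leq_trans (_ : \sum_(v | edge v x && (v != y)) (a - b) <= _).
    apply: leq_sum => v /andP[_ nvy].
    by rewrite (_ : [exists y0, (y0 != v) && private I x y0]) ?muln1 //; apply/existsP; exists y; rewrite eq_sym nvy.
  rewrite sum_nat_const leq_mul2r; apply/orP; right.
  rewrite -(card_edge regG x) (cardD1 y [pred u | edge x u]) inE exy add1n /=.
  by apply: subset_leq_card; apply/subsetP => v; rewrite !inE edge_sym andbC.
have d0 : 0 < d by rewrite -(card_edge regG x); apply/card_gt0P; exists y; rewrite inE.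
have := leq_add (leq_subr (b * [exists y0, (y0 != y) && private I x y0]) a) le1.
case: (d) d0 => // d' _; rewrite /= mulnBr !mulSn => le2.
have : d' * b <= d' * a by rewrite leq_mul2l le_ba orbT.
move: le2; rewrite (mulnC b); lia.
Qed.

(** Isolated leaves of weight 0 leave a single choice, so only [k], the number of available ones,
    varies. *)
Lemma smergel_leaves (w : G -> nat) A l : (forall x, x \in l -> w x = 0) ->
  exists k, [/\ smergel [seq st w ([set x] :&: A) x | x <- l] = (k, (1, 0)%Z, (1, 0)%Z) &
    (k == 0) = ~~ has (mem A) l].
Proof.
elim: l => [_|x l IH w0]; first by exists 0.
have [k [e ek]] : exists k, [/\ smergel [seq st w ([set x] :&: A) x | x <- l] = (k, (1, 0)%Z, (1, 0)%Z) &
    (k == 0) = ~~ has (mem A) l] by apply: IH => y yl; apply: w0; rewrite inE yl orbT.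
rewrite [smergel _]/(smerge (st w ([set x] :&: A) x) (smergel _)) e [has _ _]/=.
have [xA|nxA] := boolP (x \in A); last first.
  exists k; split; last by rewrite ek.
  have -> : [set x] :&: A = set0; last by rewrite st_set0.
  by apply/setP => y; rewrite !inE; case: eqP => // ->; rewrite (negPf nxA).
exists k.+1; split=> //; rewrite (setIidPl _) ?sub1set //.
have := @st_star _ w (fun=> set0) [::] x isT (fun x y xs => False_ind _ (notF xs)) (fun x xs => False_ind _ (notF xs)).
by rewrite big_nil setU0 w0 ?mem_head // => ->.
Qed.

Lemma private_bound : 0 < d -> private_check d D a b ->
  D * #|G| <= (D + d * a) * alpha G.
Proof.
move=> d0 /allP chk.
apply: (double_count (f := fun v I => priv_val I v)) => [I _|v _]; first exact: sum_priv_val.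
apply: (@resample _ (v |: \bigcup_(c <- nbrs v) branch 2 v c)) => J dis.
set B := v |: _ in dis *.
have vf : v \in free J.
  apply: (ball_disjoint_free dis) => z vz; right; exists z; rewrite ?mem_nbrs //.
  by apply/branchS; left.
have inB y : y \in B -> y \notin J by move=> yB; rewrite (disjointFr dis).
have cB c : edge v c -> c \in B.
  by move=> vc; apply/setU1P; right; apply/in_bigcup_seq; exists c; rewrite ?mem_nbrs //; apply/branchS; left.
have xB c x : edge v c -> edge c x -> x \in B.
  move=> vc cx; have [->|xv] := eqVneq x v; first exact: setU11.
  apply/setU1P; right; apply/in_bigcup_seq; exists c; rewrite ?mem_nbrs //.
  by apply/branchS; right; exists x; split=> //; apply/branchS; left.
have cf c : edge v c -> c \in free J.
  by move=> vc; apply: (free_interior dis) => x; apply: xB.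
pose L c := has (mem (free J)) (kids v c).
(* [w] bounds [priv_val] from below in terms of [J] alone. If no leaf below [c] is available, each
   neighbour of [c] other than [v] is adjacent to [J]: then [c] is private to [v] whenever [v] is in
   [I], and only [v] could be private to [c]. *)
pose w x := if x == v then D + b * d.-1 * [exists c, edge v c && ~~ L c]
  else if edge v x then a - b * L x else 0.
apply: leq_trans (_ : \sum_(K in MI (B :&: free J)) \sum_(x in K) w x <= _); last first.
  apply: leq_sum => K /MIP[]; rewrite subsetI => /andP[/subsetP sKB /subsetP sKf] _ _.
  rewrite /priv_val (bigID (pred1 v)) /=; apply: leq_add.
    rewrite inE (negPf (inB v (setU11 _ _))) orbF.
    have [vK|nvK] := boolP (v \in K); last first.
      by rewrite big1 // => x /andP[xK /eqP exv]; move: nvK; rewrite -exv xK.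
    rewrite (bigD1 v) ?vK ?eqxx //= big1 => [|x /andP[/andP[_ /eqP->]]]; last by rewrite eqxx.
    rewrite mul1n addn0 /w eqxx leq_add2l leq_mul2l; apply/orP; right.
    case: existsP => // -[c /andP[vc nL]].
    rewrite (_ : [exists y, private (K :|: J) v y]) //; apply/existsP; exists c.
    rewrite /private vc; apply/forall_inP => z; rewrite inE => zKJ; apply/implyP => cz.
    have zB := xB _ _ vc cz; move: zKJ; rewrite (negPf (inB _ zB)) orbF => zK.
    apply: contraNT nL => nzv; apply/hasP; exists z; first by rewrite mem_kids cz.
    exact: sKf.
  rewrite [X in X <= _](bigID (edge v)) /= [X in _ + X]big1 ?addn0; last first.
    by move=> x /andP[/andP[_ /negPf xv] /negPf vx]; rewrite /w xv vx.
  rewrite [X in X <= _](eq_bigl (fun x => (x \in K :|: J) && edge v x)); last first.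
    move=> x; case vx: (edge v x); rewrite ?andbF // !andbT inE (negPf (inB _ (cB _ vx))) orbF.
    by rewrite (_ : x != v) ?andbT //; apply: contraTneq vx => ->; rewrite edge_irrefl.
  apply: leq_sum => c /andP[_ vc]; rewrite /w vc.
  have -> : (c == v) = false by apply/eqP => ecv; move: vc; rewrite ecv edge_irrefl.
  rewrite leq_sub2l // leq_mul2l; apply/orP; right; case: existsP => // -[y /andP[yv /andP[cy /forall_inP py]]].
  rewrite (_ : L c) //; apply/hasP; exists y; first by rewrite mem_kids cy.
  rewrite /= inE; apply/forall_inP => x xJ; apply/negP => exy.
  have := py x; rewrite inE xJ orbT edge_sym exy /= => /(_ isT) /eqP exc.
  by have := inB _ (cB _ vc); rewrite -exc xJ.
have stc c : edge v c -> st w (branch 2 v c :&: free J) c \in private_states a b /\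
    (L c -> is_k 0 (st w (branch 2 v c :&: free J) c)).
  move=> vc.
  have -> : branch 2 v c = c |: \bigcup_(x <- kids v c) branch 1 c x by [].
  rewrite (setI_star _ _ (cf c vc)).
  have wc : w c = a - b * L c.
    by rewrite /w vc; case: eqP => // ecv; move: vc; rewrite ecv edge_irrefl.
  have adjc x y : x \in kids v c -> y \in branch 1 c x -> y = x.
    by move=> _ /branchS[//|[z [_ _]]]; rewrite inE.
  rewrite st_star ?uniq_kids //; last first.
  - move=> x xk y /setIP[yx _]; rewrite (adjc _ _ xk yx).
    move: xk; rewrite mem_kids => /andP[cx _]; rewrite cx eqxx andbT.
    by apply: contraTneq cx => ->; rewrite edge_irrefl.
  - move=> x x'; rewrite !mem_kids => /andP[cx _] /andP[cx' _] nxx y y' /setIP[yx _] /setIP[yx' _].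
    by apply: (separated_branch girthG cx cx' nxx _ yx yx').
  have w0 x : x \in kids v c -> w x = 0.
    rewrite mem_kids => /andP[cx xv]; rewrite /w (negPf xv); case: ifP => // vx.
    have x2 : x \in branch 2 v c by apply/branchS; right; exists x; split=> //; apply/branchS; left.
    have /andP[_] := branch_adj girthG vc (isT : 2 + 1 < 6) x2.
    by rewrite vx => /eqP/esym/eqP exc; move: cx; rewrite exc edge_irrefl.
  have [k [e ek]] := @smergel_leaves w (free J) _ w0.
  have -> : [seq st w (branch 1 c x :&: free J) x | x <- kids v c] =
            [seq st w ([set x] :&: free J) x | x <- kids v c].
    apply/eq_in_map => x xk; congr (st _ (_ :&: _) _); apply/setP => y; rewrite in_set1.
    by apply/idP/eqP => [/(adjc _ _ xk)|->] //; apply/branchS; left.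
  rewrite e wc; move: ek; rewrite -/(L c); case: (L c) => /=; case: k {e} => [|[|k]] // _; split=> //.
  - rewrite !inE; apply/or3P; constructor 2; apply/eqP; rewrite muln1 /dadd /dlift [fst _]/= [snd _]/=.
    by congr (_, _, (_, _)); rewrite /=; lia.
  - rewrite !inE; apply/or3P; constructor 1; apply/eqP; rewrite muln0 subn0 /dlift [fst _]/= [snd _]/=.
    by congr (_, _, (_, _)); rewrite /=; lia.
have lt1 : 2 + 2 + 1 < 6 by [].
have eT : st w (B :&: free J) v =
    vtx (Z.of_nat (w v)) (smergel [seq st w (branch 2 v c :&: free J) c | c <- nbrs v]).
  rewrite (setI_star _ _ vf); apply: st_star (uniq_nbrs v) _ _.
    move=> x y; rewrite !mem_nbrs => vx vy nxy y1 y2 /setIP[y1x _] /setIP[y2y _].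
    exact: (separated_branch girthG vx vy nxy lt1 y1x y2y).
  by move=> x; rewrite mem_nbrs => vx y /setIP[yx _]; apply: (branch_adj girthG vx _ yx).
have stsC : smergel [seq st w (branch 2 v c :&: free J) c | c <- nbrs v]
    \in combos (private_states a b) d.
  have <- : size [seq st w (branch 2 v c :&: free J) c | c <- nbrs v] = d.
    by rewrite size_map size_nbrs regG.
  by apply: smergel_combos => s /mapP[c]; rewrite mem_nbrs => vc ->; case: (stc c vc).
have : good (Z.of_nat D) (Z.of_nat (w v))
    (smergel [seq st w (branch 2 v c :&: free J) c | c <- nbrs v]).
  have /andP[good1 /implyP good0] := chk _ stsC; rewrite {1}/w eqxx.
  case: existsP => [_|noL]; first by rewrite muln1.
  rewrite muln0 addn0; apply: good0; apply/eqnP; apply: smergel_k0.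
  apply/allP => s /mapP[c]; rewrite mem_nbrs => vc ->; apply: (stc c vc).2.
  by apply/negPn/negP => nL; apply: noL; exists c; rewrite vc.
by rewrite /good -eT /st /opt /= => /Z.leb_spec0 /=; lia.
Qed.

End PrivateNeighbours.

(** * Reduction to regular graphs *)

Section WordAction.

Variables (E : finType) (L : nat).
Implicit Types (e : E) (w : seq E).

Definition reduced w := path.sorted (fun e f => e != f) w.

(* The action of the generator [e] on the reduced words of length at most [L]. *)
Definition toggle e w : seq E :=
  if w is f :: w' then
    if f == e then w' else if size w < L then e :: w else w
  else if 0 < L then [:: e] else [::].

Lemma toggle_reduced e w : reduced w -> reduced (toggle e w).
Proof.
case: w => [|f w] /=; first by case: ifP.
rewrite /reduced; case: eqP => [_|/eqP nfe] /= rw; first exact: path_sorted rw.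
by case: ifP => _ //=; rewrite eq_sym nfe.
Qed.

Lemma size_toggle e w : size w <= L -> size (toggle e w) <= L.
Proof.
by case: w => [|f w] /= sw; [case: ifP | case: eqP => _; [apply: ltnW | case: ifP]].
Qed.

Lemma toggleK e w : reduced w -> size w <= L -> toggle e (toggle e w) = w.
Proof.
case: w => [|f w] /= rw sw; first by case: ifP => L0 /=; rewrite ?eqxx ?L0.
have [efe|nfe] := eqVneq f e.
  rewrite -efe; case: w rw sw => [|h w] /=; first by move=> _ ->.
  by move=> /andP[nfh _] sw; rewrite eq_sym (negPf nfh) ifT.
by case: ifP => lt /=; rewrite ?eqxx ?(negPf nfe) ?lt.
Qed.

(** Words that are not reduced are fixed, so that the generator acts as an involution on a whole
    finite type. *)
Definition act_word e (w : L.-bseq E) : L.-bseq E :=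
  if reduced w then insub_bseq L (toggle e w) else w.

Lemma val_act_word e (w : L.-bseq E) : reduced w -> act_word e w = toggle e w :> seq E.
Proof.
by move=> rw; rewrite /act_word rw insubdK // unfold_in size_toggle // size_bseq.
Qed.

Lemma act_wordK e : involutive (act_word e).
Proof.
move=> w; have [rw|nrw] := boolP (reduced w); last by rewrite /act_word (negPf nrw) (negPf nrw).
apply/val_inj; rewrite /= val_act_word val_act_word ?toggle_reduced //.
by rewrite toggleK ?size_bseq.
Qed.

Definition word_perm e : {perm L.-bseq E} := perm (inv_inj (act_wordK e)).

Lemma word_permK e : (word_perm e * word_perm e = 1)%g.
Proof. by apply/permP => w; rewrite permM perm1 !permE act_wordK. Qed.

Lemma word_perm_nil e : 0 < L -> word_perm e [bseq] = [:: e] :> seq E.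
Proof. by move=> L0; rewrite permE val_act_word //= L0. Qed.

Lemma word_perm_inj : 0 < L -> injective word_perm.
Proof.
move=> L0 e f /(congr1 (fun s : {perm _} => val (s [bseq]))).
by rewrite /= !word_perm_nil // => -[].
Qed.

Lemma word_perm_neq1 e : 0 < L -> word_perm e != 1%g.
Proof.
move=> L0; apply/eqP => /(congr1 (fun s : {perm _} => val (s [bseq]))).
by rewrite /= word_perm_nil // perm1.
Qed.

End WordAction.

Section Regularization.

Variables (G : sgraph) (d g : nat).
Hypothesis g0 : 0 < g.
Hypothesis maxG : forall x : G, degree x <= d.
Hypothesis girthG : girth_geq g G.

Let E : finType := (G * 'I_d)%type.
Let P : finType := {perm g.-bseq E}.
Let s_ (e : E) : P := word_perm g e.

(** The vertex [x] lacks [d - degree x] edges; the [i]-th of them leads to the copy of [x] reached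
    by the generator [(x, i)]. The copies are indexed by the whole permutation group of the
    words. *)
Definition jump (x : G) (s t : P) :=
  [exists i : 'I_d, (i < d - degree x) && (t == s * s_ (x, i))%g].

Definition reg_edge : rel (G * P) := fun z z' =>
  (edge z.1 z'.1 && (z.2 == z'.2)) || ((z.1 == z'.1) && jump z.1 z.2 z'.2).

Lemma jump_sym x s t : jump x s t = jump x t s.
Proof.
wlog suff : s t / jump x s t -> jump x t s by move=> H; apply/idP/idP; apply: H.
case/existsP => i /andP[lti /eqP->]; apply/existsP; exists i.
by rewrite lti -mulgA word_permK mulg1 eqxx.
Qed.

Lemma jump_irrefl x s : jump x s s = false.
Proof.
apply/existsP => -[i /andP[_ /eqP]]; rewrite -{1}[s]mulg1 => /mulgI/esym/eqP.
by rewrite (negPf (word_perm_neq1 _ g0)).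
Qed.

Lemma reg_edge_sym : symmetric reg_edge.
Proof.
move=> z z'; rewrite /reg_edge edge_sym [z.2 == _]eq_sym; congr (_ || _).
by rewrite eq_sym; case: eqP => //= ->; rewrite jump_sym.
Qed.

Lemma reg_edge_irrefl : irreflexive reg_edge.
Proof. by move=> z; rewrite /reg_edge edge_irrefl jump_irrefl andbF. Qed.

Definition regularize : sgraph := SGraph reg_edge_sym reg_edge_irrefl.

Lemma degree_regularize (z : regularize) : degree z = d.
Proof.
case: z => x s; rewrite /degree.
pose A := [set (y, s) | y in [set y | edge x y]].
pose B := [set (x, s * s_ (x, i))%g | i in [set i : 'I_d | i < d - degree x]].
have -> : [set z' | edge (s := regularize) (x, s) z'] = A :|: B.
  apply/setP => -[y t]; rewrite !inE /= /reg_edge /=; congr (_ || _).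
    apply/andP/imsetP => [[exy /eqP ->]|[y']]; first by exists y; rewrite ?inE.
    by rewrite inE => exy [-> ->].
  apply/andP/imsetP => [[/eqP <- /existsP[i /andP[lti /eqP ->]]]|[i]].
    by exists i; rewrite ?inE.
  by rewrite inE => lti [-> ->]; split=> //; apply/existsP; exists i; rewrite lti eqxx.
rewrite cardsU (_ : A :&: B = set0) ?cards0 ?subn0; last first.
  apply/setP => -[y t]; rewrite !inE; apply/andP => -[/imsetP[y' _ [_ ->]] /imsetP[i _ [_]]].
  rewrite -{1}[s]mulg1 => /mulgI/esym/eqP.
  by rewrite (negPf (word_perm_neq1 _ g0)).
rewrite card_imset => [|y y' [] //]; rewrite card_in_imset; last first.
  by move=> i j _ _ [] /mulgI /(word_perm_inj g0) [].
rewrite -/(degree x) -[RHS](subnKC (maxG x)); congr (_ + _).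
rewrite cardsE -sum1_card -(big_ord_widen d (fun=> 1)) ?leq_subr //.
by rewrite sum1_card card_ord.
Qed.

Section ShortPaths.

Variable z0 : G * P.

(** The image of the empty word under the group element leading from the copy of [z0] to that of
    [z]. Along a path with fewer than [g] edges the bound on the length of words does not interfere,
    and this is the word of the jumps, the latest one first. *)
Let word (z : G * P) : seq E := z.2 (z0.2^-1%g [bseq]).

Lemma word_jump z e : reduced (word z) ->
  word (z.1, z.2 * s_ e)%g = toggle g e (word z).
Proof. by move=> rz; rewrite /word /= permM permE val_act_word. Qed.

(* Along a path of [regularize] the word never gets shorter: cancelling its first
   letter would lead back to a vertex already visited. *)
Lemma word_path p : path reg_edge z0 p -> uniq (z0 :: p) -> size p < g ->
  let z := last z0 p in
  [/\ reduced (word z), size (word z) <= size p,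
      word z = [::] -> {in z0 :: p, forall y, y.2 = z0.2} &
      forall e w, word z = e :: w ->
        exists p1 p2, z0 :: p = p1 ++ [:: (e.1, z.2 * s_ e)%g, (e.1, z.2) & p2]].
Proof.
have wz0 : word z0 = [::] by rewrite /word permKV.
elim/last_ind: p => [|p z' IH].
  by rewrite /= wz0; split=> // _ y; rewrite inE => /eqP->.
rewrite rcons_path last_rcons -rcons_cons rcons_uniq size_rcons => /andP[pth ezz'] /andP[nz' un] lt.
have [rz sz emp top] := IH pth un (ltnW lt).
set z := last z0 p in ezz' rz sz emp top *; rewrite /=.
case/orP: ezz' => [/andP[_ /eqP e2]|/andP[/eqP e1 /existsP[i /andP[_ /eqP e2]]]].
  have ew : word z' = word z by rewrite /word e2.
  rewrite ew; split=> //; first exact: leqW.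
    move=> wz y; rewrite -rcons_cons mem_rcons inE => /predU1P[->|]; last exact: emp.
    by rewrite -e2; apply: emp => //; rewrite /z mem_last.
  move=> e w /top[p1 [p2 ep]]; exists p1, (rcons p2 z').
  by rewrite -e2 -rcons_cons ep rcons_cat.
have ez' : z' = (z.1, z.2 * s_ (z.1, i))%g by case: (z') e1 e2 => ? ? /= <- ->.
have ew : word z' = (z.1, i) :: word z.
  rewrite ez' word_jump // /toggle; case ewz: (word z) => [|e w]; first by rewrite g0.
  have [ee|_] := eqVneq e (z.1, i).
    have [p1 [p2 ep]] := top _ _ ewz; case/negP: nz'.
    by rewrite ep ez' mem_cat inE ee eqxx orbT.
  by rewrite -ewz ifT //; apply: leq_ltn_trans sz _; apply: ltnW.
rewrite ew; split=> //.
  rewrite -ew ez' word_jump //; exact: toggle_reduced.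
move=> e w [<- _]; exists (seq.belast z0 p), [::].
have -> : ((z.1, i).1, z'.2 * s_ (z.1, i))%g = z.
  by rewrite e2 -mulgA word_permK mulg1; case: (z).
have -> : ((z.1, i).1, z'.2) = z' by rewrite e2 ez'.
by rewrite -rcons_cons lastI -/z -!cats1 -catA.
Qed.

End ShortPaths.

(** If the closing edge of a short cycle stays in a copy, the word at the end is empty, so the whole
    cycle lies in one copy and projects to a cycle of [G]. If it is a jump, the word has one letter,
    whose jump is the first edge of the path, from [z0] to [z]; then the cycle has only two
    vertices. *)
Lemma girth_regularize : girth_geq g regularize.
Proof.
move=> [|z0 p] [] //= sz3 /andP[cyc un]; rewrite leqNgt; apply/negP => lt.
move: cyc; rewrite /path.cycle rcons_path => /andP[pth cl].
have [rz sz emp top] := word_path pth un (ltnW lt).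
set z := last z0 p in cl rz sz emp top.
case/orP: cl => [/andP[exz /eqP e2]|/andP[/eqP e1 /existsP[i /andP[_ /eqP e2]]]].
  have same : {in z0 :: p, forall y, y.2 = z0.2} by apply: emp; rewrite e2 permKV.
  have cG : is_cycle [seq y.1 | y <- z0 :: p].
    split; first by rewrite size_map.
    have inj : {in z0 :: p &, injective (fst : G * P -> G)}.
      by move=> [x s] [y t] /same /= -> /same /= -> /= ->.
    rewrite /ucycle map_inj_in_uniq // un andbT /= rcons_path last_map exz andbT.
    elim: (p) (z0) pth same => //= y q IH x /andP[exy pq] same.
    have exy2 : y.2 = x.2 by apply: same; rewrite !inE eqxx orbT.
    apply/andP; split; last first.
      by apply: IH => // y' y'q; rewrite exy2; apply: same; rewrite inE y'q orbT.
    case/orP: exy => [/andP[] //|/andP[_]].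
    by rewrite exy2 jump_irrefl.
  by have := girthG cG; rewrite size_map /=; lia.
have ez0 : z0 = (z.1, z.2 * s_ (z.1, i))%g by case: (z0) e1 e2 => ? ? /= <- ->.
have : toggle g (z.1, i) (z.2 (z0.2^-1%g [bseq])) = [::].
  rewrite -word_jump //.
  by rewrite /= -e2 permKV.
case ew: (bseqval _) => [|e w] /=; first by rewrite g0.
case: eqP => [ee _|_]; last by case: ifP.
have [p1 [p2 ep]] := top _ _ ew.
have : (e.1, z.2 * s_ e)%g = z0 by rewrite ee -ez0.
move=> ez0'; rewrite ez0' in ep.
case: p1 ep => [[ep]|y p1 [ey ep]]; last first.
  by move: un; rewrite [uniq _]/= ep mem_cat inE eqxx orbT.
have : uniq p by case/andP: un.
move: sz3 (erefl z); rewrite {2}/z ep; case: p2 {ep} => //= y p2 _ ez.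
have -> : (e.1, z.2) = z by rewrite ee; case: (z).
by rewrite {1}ez mem_last.
Qed.

(** Each of the [#|P|] copies of [G] meets [I] in an independent set of [G]. Hence the ratio does
    not decrease when [G] is regularized. *)
Lemma alpha_regularize : alpha regularize <= #|P| * alpha G.
Proof.
apply/bigmax_leqP => I iI.
have -> : #|I| = \sum_(s : P) #|[set x | (x, s) \in I]|.
  rewrite -sum1_card (eq_bigl (fun z : G * P => predT z.1 && ((z.1, z.2) \in I))); last by case.
  rewrite -(pair_big_dep predT (fun x s => (x, s) \in I) (fun _ _ => 1)) /=.
  rewrite (exchange_big_dep predT) //=; apply: eq_bigr => s _.
  by rewrite -sum1_card; apply: eq_bigl => x; rewrite inE.
rewrite -sum_nat_const; apply: leq_sum => s _.
rewrite -mis_alpha; apply: leq_mis; rewrite ?subsetT //; apply/independentP => x y.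
rewrite !inE => Ix Iy; move/independentP: iI => /(_ _ _ Ix Iy).
by rewrite /= /reg_edge /= negb_or eqxx andbT => /andP[].
Qed.

End Regularization.

Lemma regular_reduction (d g C D : nat) : 0 < g ->
  (forall H : sgraph, girth_geq g H -> (forall x : H, degree x = d) ->
     D * #|H| <= C * alpha H) ->
  forall G : sgraph, (forall x : G, degree x <= d) -> girth_geq g G ->
    D * #|G| <= C * alpha G.
Proof.
move=> g0 reg G maxG girthG.
have [K0|K0] := posnP #|{: {perm g.-bseq (G * 'I_d)}}|.
  by have := fintype0 (1%g : {perm g.-bseq (G * 'I_d)}); rewrite K0 => /(_ erefl).
have := reg _ (@girth_regularize G d g g0 girthG) (@degree_regularize G d g g0 maxG).
rewrite card_prod => le1; rewrite -(leq_pmul2r K0).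
have le2 := @alpha_regularize G d g g0.
rewrite -mulnA -[X in _ <= X]mulnA; apply: leq_trans le1 _.
by rewrite leq_mul2l [X in _ <= X]mulnC le2 orbT.
Qed.

(** * The bounds *)

Lemma degree_le_max (G : sgraph) (x : G) : degree x <= max_degree G.
Proof. exact: leq_bigmax. Qed.

Lemma girth_le (G : sgraph) (c : seq G) : is_cycle c -> Rbar_le (girth G) (INR (size c)).
Proof. by move=> cc; apply: (Glb_Rbar_correct _).1; exists c. Qed.

Lemma girth_geqE (g : nat) (G : sgraph) : Rbar_le (INR g) (girth G) -> girth_geq g G.
Proof.
move=> gG c /girth_le /(Rbar_le_trans _ _ _ gG) /= /INR_le; lia.
Qed.

Lemma geq_girthE (g : nat) (G : sgraph) : girth_geq g G -> Rbar_le (INR g) (girth G).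
Proof.
move=> gG; apply: (Glb_Rbar_correct _).2 => r [c /gG le ->] /=.
by apply: le_INR; lia.
Qed.

Lemma alpha_gt0 (G : sgraph) : 0 < #|G| -> 0 < alpha G.
Proof.
move=> /card_gt0P[x _]; rewrite -mis_alpha.
apply: leq_trans (leq_mis (K := [set x]) (subsetT _) _); first by rewrite cards1.
by apply/independentP => y z /set1P -> /set1P ->; rewrite edge_irrefl.
Qed.

Lemma rho_le (d g : nat) (C D : N) (p q : Z) : 0 < g -> (0 < D)%num -> (0 < q)%Z ->
  (forall H : sgraph, girth_geq g H -> (forall x : H, degree x = d) ->
     N.to_nat D * #|H| <= N.to_nat C * alpha H) ->
  (Z.of_N C * q <= p * Z.of_N D)%Z ->
  Rbar_le (rho d g) (IZR p / IZR q)%R.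
Proof.
move=> g0 D0 q0 reg le; apply: (Lub_Rbar_correct _).2 => r [G [G0 [maxG /girth_geqE gG]] ->].
have a0 := alpha_gt0 G0.
have deg (x : G) : degree x <= d by apply: leq_trans (degree_le_max x) maxG.
have b := regular_reduction g0 reg deg gG.
rewrite /= /indep_ratio !INR_IZR_INZ.
have bZ : (Z.of_N D * Z.of_nat #|G| <= Z.of_N C * Z.of_nat (alpha G))%Z.
  by rewrite -!N_nat_Z; lia.
have aR : (0 < IZR (Z.of_nat (alpha G)))%R by apply: IZR_lt; lia.
have qR : (0 < IZR q)%R by apply: IZR_lt.
apply: (Rmult_le_reg_r (IZR (Z.of_nat (alpha G)) * IZR q)); first exact: Rmult_lt_0_compat.
have -> : (IZR (Z.of_nat #|G|) / IZR (Z.of_nat (alpha G)) * (IZR (Z.of_nat (alpha G)) * IZR q) =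
  IZR (Z.of_nat #|G| * q))%R by rewrite mult_IZR; field; lra.
have -> : (IZR p / IZR q * (IZR (Z.of_nat (alpha G)) * IZR q) =
  IZR (p * Z.of_nat (alpha G)))%R by rewrite mult_IZR; field; lra.
apply: IZR_le; apply: (Zmult_le_reg_r _ _ (Z.of_N D)); first lia.
have := Z.mul_le_mono_nonneg_r _ _ q (Z.lt_le_incl _ _ q0) bZ.
have := Z.mul_le_mono_nonneg_r _ _ (Z.of_nat (alpha G)) (Nat2Z.is_nonneg _) le.
lia.
Qed.

(** [D], [a0] and [l] are a solution of the linear program scaled to integers; the ratio that it
    proves is [(a0 + flow d l) / D]. *)
Definition vertex_cert (d g : nat) (D a0 : N) (l : seq N) (mp mq p q : Z) : bool :=
  [&& 0 < d, 0 < size l, (size l).*2.+1 < g,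
      N.ltb 0 D && Z.ltb 0 q, Z.leb (Z.of_N (a0 + flow d l) * q) (p * Z.of_N D) &
      vertex_root_check d (Z.of_N D) (Z.of_N a0) mp mq (table d l)].

Lemma vertex_rho d g D a0 l mp mq p q : vertex_cert d g D a0 l mp mq p q ->
  Rbar_le (rho d g) (IZR p / IZR q)%R.
Proof.
case/and5P => d0 l0 lt /andP[/N.ltb_spec0 D0 /Z.ltb_spec0 q0] /andP[/Z.leb_spec0 le chk].
apply: (@rho_le d g (a0 + flow d l)%num D) => //; first by apply: leq_ltn_trans lt.
by move=> H gH degH; apply: (vertex_bound gH degH d0 l0 lt chk).
Qed.

Definition edge_cert (d g : nat) (D a0 : N) (l : seq N) (p q : Z) : bool :=
  [&& 0 < d, 0 < size l, (size l).*2.+2 < g,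
      N.ltb 0 D && Z.ltb 0 q,
      Z.leb (Z.of_N (2 * flow d (a0 :: l)) * q) (p * Z.of_N (D * N.of_nat d)) &
      edge_root_check d (Z.of_N D) (a0 :: l)].

Lemma edge_rho d g D a0 l p q : edge_cert d g D a0 l p q ->
  Rbar_le (rho d g) (IZR p / IZR q)%R.
Proof.
case/and5P => d0 l0 lt /andP[/N.ltb_spec0 D0 /Z.ltb_spec0 q0] /andP[/Z.leb_spec0 le chk].
apply: (@rho_le d g (2 * flow d (a0 :: l))%num (D * N.of_nat d)%num) => //.
- exact: leq_ltn_trans lt.
- by lia.
move=> H gH degH; have := edge_bound gH degH d0 l0 lt chk.
by rewrite mulnA !N2Nat.inj_mul Nat2N.id.
Qed.

Definition private_cert (d D a b : nat) (p q : Z) : bool :=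
  [&& 0 < d, b <= a, (0 < D) && Z.ltb 0 q,
      Z.leb (Z.of_nat (D + d * a) * q) (p * Z.of_nat D) & private_check d D a b].

Lemma private_rho d g D a b p q : 6 <= g -> private_cert d D a b p q ->
  Rbar_le (rho d g) (IZR p / IZR q)%R.
Proof.
move=> g6 /and5P[d0 ba /andP[D0 /Z.ltb_spec0 q0] /Z.leb_spec0 le chk].
apply: (@rho_le d g (N.of_nat (D + d * a)) (N.of_nat D)) => //; try lia.
move=> H gH degH; rewrite !Nat2N.id; apply: private_bound degH ba d0 chk.
by move=> c /gH; apply: leq_trans.
Qed.

(** * Equality with the supremum of the Hall ratios *)

Section Subgraphs.

Variables (G : sgraph) (S : {set G}) (F : {set {set G}}).

Lemma card_subgraph : #|subgraph S F| = #|S|.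
Proof. by rewrite card_sig; apply: eq_card => x; rewrite !inE. Qed.

Lemma degree_subgraph (u : subgraph S F) : degree u <= degree (val u).
Proof.
rewrite /degree -(card_imset _ val_inj); apply: subset_leq_card.
by apply/subsetP => y /imsetP[v]; rewrite !inE => /andP[e _] ->.
Qed.

Lemma girth_geq_subgraph g : girth_geq g G -> girth_geq g (subgraph S F).
Proof.
move=> gG c [sz /andP[cyc un]]; rewrite -(size_map val); apply: gG; split; first by rewrite size_map.
rewrite /ucycle (map_inj_uniq val_inj) un andbT.
case: c cyc {sz un} => //= x c; rewrite -map_rcons.
by apply: homo_path => u v /andP[].
Qed.

Lemma in_class_subgraph d g : S != set0 -> in_class d g G -> in_class d g (subgraph S F).
Proof.
move=> S0 [_ [maxG /girth_geqE gG]]; split; first by rewrite card_subgraph card_gt0.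
split; last by apply/geq_girthE/girth_geq_subgraph.
apply/bigmax_leqP => u _; apply: leq_trans maxG.
exact: leq_trans (degree_subgraph u) (degree_le_max _).
Qed.

End Subgraphs.

Lemma alpha_subgraphT (G : sgraph) : alpha (subgraph [set: G] [set: {set G}]) <= alpha G.
Proof.
apply/bigmax_leqP => A /independentP iA.
rewrite -(card_imset _ val_inj) -mis_alpha; apply: leq_mis; rewrite ?subsetT //.
apply/independentP => _ _ /imsetP[u Au ->] /imsetP[v Av ->].
by have := iA _ _ Au Av; rewrite /= /sub_edge /= in_setT andbT.
Qed.

Lemma bigRmax_ge (I : finType) (P : pred I) (F : I -> R) i : P i ->
  (F i <= \big[Rmax/0%R]_(j | P j) F j)%R.
Proof.
move=> Pi; rewrite -big_filter.
have : i \in [seq j <- index_enum I | P j] by rewrite mem_filter Pi mem_index_enum.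
elim: (filter _ _) => //= j s IH; rewrite inE big_cons => /predU1P[<-|/IH le].
  exact: Rmax_l.
by apply: Rle_trans le _; apply: Rmax_r.
Qed.

Lemma indep_ratio_le_hall (G : sgraph) : 0 < #|G| -> (indep_ratio G <= hall_ratio G)%R.
Proof.
move=> G0; have T0 : [set: G] != set0 by rewrite -card_gt0 cardsT.
have := @bigRmax_ge _ (fun S : {set G} => S != set0)
  (fun S => \big[Rmax/0%R]_(F : {set {set G}}) indep_ratio (subgraph S F)) _ T0.
apply: Rle_trans.
have := @bigRmax_ge {set {set G}} predT
  (fun F => indep_ratio (subgraph [set: G] F)) [set: {set G}] isT.
apply: Rle_trans.
rewrite /indep_ratio card_subgraph cardsT.
apply: Rmult_le_compat_l; first exact: pos_INR.
apply: Rinv_le_contravar; last by apply: le_INR; have := alpha_subgraphT G; lia.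
by apply: (lt_INR 0); have := @alpha_gt0 (subgraph [set: G] [set: {set G}]); rewrite card_subgraph cardsT; lia.
Qed.

(** A graph is one of its own subgraphs, and the class is closed under nonempty subgraphs. The unit
    0 of [Rmax] is also at most [rho d g], since the class contains [G]. *)
Lemma rho_hallE (d g : nat) : rho d g = rho_hall d g.
Proof.
apply: Rbar_le_antisym; apply: (Lub_Rbar_correct _).2 => r [G Gdg ->].
  apply: (@Rbar_le_trans _ (hall_ratio G)); first by apply: indep_ratio_le_hall; case: Gdg.
  by apply: (Lub_Rbar_correct _).1; exists G.
have ub H : in_class d g H -> Rbar_le (indep_ratio H) (rho d g).
  by move=> Hdg; apply: (Lub_Rbar_correct _).1; exists H.
have ub0 : Rbar_le 0%R (rho d g).
  apply: Rbar_le_trans (ub G Gdg); apply: Rdiv_le_0_compat; first exact: pos_INR.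
  by apply: (lt_INR 0); case: Gdg => G0 _; have := alpha_gt0 G0; lia.
have ubM x y : Rbar_le (Finite x) (rho d g) -> Rbar_le (Finite y) (rho d g) -> Rbar_le (Finite (Rmax x y)) (rho d g).
  by move=> xr yr; rewrite /Rmax; case: Rle_dec.
rewrite /hall_ratio; apply: (big_ind (fun x => Rbar_le (Finite x) (rho d g))) => // S S0.
apply: (big_ind (fun x => Rbar_le (Finite x) (rho d g))) => // F _.
exact/ub/in_class_subgraph.
Qed.

Local Open Scope R_scope.

Theorem theorem1p13 :
  (forall d g : nat, (1 <= d)%nat -> (3 <= g)%nat -> rho d g = rho_hall d g) /\
  (Rbar_le (rho 3 6) (30 / 11) /\
   Rbar_le (rho 3 7) (30 / 11) /\
   Rbar_le (rho 3 8) (5849 / 2228) /\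
   Rbar_le (rho 3 9) (125 / 48) /\
   Rbar_le (rho 3 10) (2098873192 / 820777797) /\
   Rbar_le (rho 3 11) (14147193 / 5571665) /\
   Rbar_le (rho 3 12) (29727802051155412 / 11841961450578397)) /\
  (Rbar_le (rho 4 6) (41 / 13) /\
   Rbar_le (rho 4 7) (41 / 13) /\
   Rbar_le (rho 4 8) (7083927 / 2331392) /\
   Rbar_le (rho 4 9) (127937 / 42400) /\
   Rbar_le (rho 4 10) 3) /\
  (Rbar_le (rho 5 6) (69 / 19) /\
   Rbar_le (rho 5 7) (18 / 5) /\
   Rbar_le (rho 5 8) (7 / 2)).
Proof.
split; first by move=> d g _ _; apply: rho_hallE.
split; [split; [|split; [|split; [|split; [|split; [|split]]]]] |
  split; [split; [|split; [|split; [|split]]] | split; [|split]]].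
(* The weights give [(7 + 3 * 4) / 7 = 19 / 7], slightly less than [30 / 11]. *)
- by apply: (@private_rho 3 6 7 4 2).
- by apply: (@private_rho 3 7 7 4 2).
(* Here [953 + 3 * 648 + 6 * 324 + 12 * 84 = 5849], and [2 * 816 + 596 = 2228] settles the case of
   two branches with [k = 1]. *)
- apply: (@vertex_rho 3 8 2228 953 [:: 648; 324; 84]%num 816 596).
  by vm_compute.
(* The ratio is [2 * 375 / (96 * 3) = 125 / 48], where 375 is the [flow] of the weights. *)
- apply: (@edge_rho 3 9 96 33 [:: 20; 9; 2]%num).
  by vm_compute.
- apply: (@vertex_rho 3 10 820777797 225822361
    [:: 167181813; 95376312; 45494784; 10554588]%num 300389733 232970976).
  by vm_compute.
- apply: (@edge_rho 3 11 44573320 8629016 [:: 6373920; 3688469; 1752117; 402569]%num).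
  by vm_compute.
(* Clearing the denominators of the weights multiplies both terms of the stated fraction by 4. *)
- apply: (@vertex_rho 3 12 47367845802313588 12109436260675888
    [:: 8865700459491920; 4448080673439150; 2026654050681425; 807320956849550;
        204596561505600]%num 16966678634275370 13762217666321300).
  by vm_compute.
(* The weights give [(19 + 4 * 10) / 19 = 59 / 19], less than [41 / 13]. *)
- by apply: (@private_rho 4 6 19 10 4).
- by apply: (@private_rho 4 7 19 10 4).
- apply: (@vertex_rho 4 8 2331392 863415 [:: 546360; 196528; 46576]%num 686088 479608).
  by vm_compute.
- apply: (@edge_rho 4 9 84800 27695 [:: 13896; 4112; 798]%num).
  by vm_compute.
- have -> : 3 = 3 / 1 by field.
  apply: (@vertex_rho 4 10 252 64 [:: 44; 16; 6; 1]%num 74 52).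
  by vm_compute.
(* The weights give [(6 + 5 * 3) / 6 = 7 / 2] already for girth 6, which covers all three bounds for
   [d = 5]. *)
- by apply: (@private_rho 5 6 6 3 1).
- by apply: (@private_rho 5 7 6 3 1).
- by apply: (@private_rho 5 8 6 3 1).
Qed.
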